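(* Let $(G,H)$ be a rooted graph. For all $p=p(n)\in[0,1]$ and $\varepsilon=\varepsilon(n)\in(0,1]$ with $1-p=\Omega(1)$ and $\Phi\to\infty$, $$\lim_{n \to \infty} \Pr\Big(\max_{\mathbf{x} \in [n]_{v_G}}|X_{\mathbf{x}} - \mu| < \varepsilon\mu\Big) = \begin{cases} 0 &\text{if } \varepsilon^2 \Phi \to 0, \\ 1 &\text{if } \varepsilon^2 \Phi = n^{\Omega(1)}, \end{cases}$$ where $\mu=\mu_{G,H}$, $X_{\mathbf{x}}=X_{G,H}(\mathbf{x})$ and $\Phi=\Phi_{G,H}$.
   Context: $\mathbb{G}_{n,p}$ is the binomial random graph on $[n]=\{1,\dots,n\}$. For a graph $F$, $v_F,e_F$ are its numbers of vertices and edges. A rooted graph $(G,H)$ consists of a graph $H$ and an induced subgraph $G\subseteq H$ with labeled root vertices $V(G)=\{1,\dots,v_G\}$, with $e_H>e_G$. $[n]_{v_G}$ is the set of tuples $\mathbf{x}=(x_1,\dots,x_{v_G})$ of distinct vertices of $[n]$. A $(G,H)$-extension of $\mathbf{x}$ is a copy of $(V(H),E(H)\setminus E(G))$ in which each $j\in V(G)$ is mapped onto $x_j$ (counted as subgraphs). $X_{G,H}(\mathbf{x})$ is the number of $(G,H)$-extensions of $\mathbf{x}$ in $\mathbb{G}_{n,p}$ and $\mu_{G,H}=\mathbb{E}X_{G,H}(\mathbf{x})$. $\Phi_{G,H}=\min\{\mu_{G,J}: G\subseteq J\subseteq H,\ e_J>e_G\}$. $1-p=\Omega(1)$ means $1-p$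 is bounded below by a positive constant; $\varepsilon^2\Phi=n^{\Omega(1)}$ means $\varepsilon^2\Phi\ge n^{c}$ for some constant $c>0$ and all large $n$. *)

(* Defs.v *)
From HB Require Import structures.
From mathcomp Require Import all_boot all_order all_algebra.
From mathcomp Require Import all_classical all_reals all_analysis.
Unset Printing Implicit Defensive.
Import Order.TTheory GRing.Theory Num.Theory.
Local Open Scope ring_scope.

Definition edge (n : nat) := {e : {set 'I_n} | #|e| == 2%N}.

Definition edges_of (n : nat) (S : {set edge n}) : {set {set 'I_n}} :=
  [set val e | e in S].

(* Rooted graphs: H lives on 'I_(g + k); the roots 1..v_G are lshift k i, i : 'I_g,
   so v_G = g and v_H = g + k.  G is the subgraph of H induced on the roots. *)
Definition roots (g k : nat) : {set 'I_(g + k)} := [set lshift k i | i : 'I_g].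

Definition root_edges (g k : nat) (E : {set {set 'I_(g + k)}}) : {set {set 'I_(g + k)}} :=
  [set e in E | e \subset roots g k].

Definition is_ext (g k n : nat) (V : {set 'I_(g + k)}) (x : {ffun 'I_g -> 'I_n})
    (phi : {ffun 'I_(g + k) -> 'I_n}) : bool :=
  [forall u in V, forall v in V, (phi u == phi v) ==> (u == v)] &&
  [forall i : 'I_g, phi (lshift k i) == x i].

Definition img (m n : nat) (phi : {ffun 'I_m -> 'I_n}) (e : {set 'I_m}) : {set 'I_n} :=
  phi @: e.

Definition copy_of (g k n : nat) (V : {set 'I_(g + k)}) (E : {set {set 'I_(g + k)}})
    (phi : {ffun 'I_(g + k) -> 'I_n}) : {set 'I_n} * {set {set 'I_n}} :=
  (phi @: V, [set img (g + k) n phi e | e in E :\: root_edges g k E]).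

(* X_{G,J}(x)(S): number of (G,J)-extensions of x in the graph S, counted as subgraphs,
   where J has vertex set V and edge set E. *)
Definition Xext (g k n : nat) (V : {set 'I_(g + k)}) (E : {set {set 'I_(g + k)}})
    (x : {ffun 'I_g -> 'I_n}) (S : {set edge n}) : nat :=
  #|[set C : ({set 'I_n} * {set {set 'I_n}})%type |
      [exists phi : {ffun 'I_(g + k) -> 'I_n},
        [&& is_ext g k n V x phi, C == copy_of g k n V E phi & C.2 \subset edges_of n S]]]|.

Definition gnp_w (R : realType) (n : nat) (p : R) (S : {set edge n}) : R :=
  p ^+ #|S| * (1 - p) ^+ (#|[set: edge n]| - #|S|).

Definition Pr (R : realType) (n : nat) (p : R) (A : pred {set edge n}) : R :=
  \sum_(S : {set edge n} | A S) gnp_w R n p S.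

Definition Ex (R : realType) (n : nat) (p : R) (f : {set edge n} -> R) : R :=
  \sum_(S : {set edge n}) gnp_w R n p S * f S.

(* mu_{G,J} = E X_{G,J}(x) for some (any) x in [n]_{v_G}; 0 if [n]_{v_G} is empty. *)
Definition mu (R : realType) (g k n : nat) (p : R) (V : {set 'I_(g + k)})
    (E : {set {set 'I_(g + k)}}) : R :=
  match [pick x : {ffun 'I_g -> 'I_n} | injectiveb x] with
  | Some x => Ex R n p (fun S => (Xext g k n V E x S)%:R)
  | None => 0
  end.

Definition ext_sub (g k : nat) (EH : {set {set 'I_(g + k)}})
    (J : {set 'I_(g + k)} * {set {set 'I_(g + k)}}) : bool :=
  [&& roots g k \subset J.1, root_edges g k EH \subset J.2, J.2 \subset EH,
      [forall e in J.2, e \subset J.1] & (#|root_edges g k EH| < #|J.2|)%N].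

(* Phi_{G,H} = min { mu_{G,J} : G ⊆ J ⊆ H, e_J > e_G } (J = H belongs to the range). *)
Definition Phi (R : realType) (g k n : nat) (p : R) (EH : {set {set 'I_(g + k)}}) : R :=
  \big[Order.min/mu R g k n p [set: 'I_(g + k)] EH]_(J | ext_sub g k EH J) mu R g k n p J.1 J.2.

Definition good (R : realType) (g k n : nat) (p eps : R) (EH : {set {set 'I_(g + k)}})
    (S : {set edge n}) : bool :=
  [forall x : {ffun 'I_g -> 'I_n}, injectiveb x ==>
     (`| (Xext g k n [set: 'I_(g + k)] EH x S)%:R - mu R g k n p [set: 'I_(g + k)] EH | < eps * mu R g k n p [set: 'I_(g + k)] EH)].

(* Main.v *)
Require Import Defs.
From HB Require Import structures.
From mathcomp Require Import all_boot all_order all_algebra.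
From mathcomp Require Import fingroup perm action primitive_action alt.
From mathcomp Require Import all_classical all_reals all_analysis.
From mathcomp Require Import fintype finset ring lra zify.
Import Order.TTheory GRing.Theory Num.Theory.
Set Implicit Arguments.
Unset Strict Implicit.
Local Open Scope ring_scope.

(** Write D for X_x - mu, a sum over the copies a of H extending x of the centred
    indicators xi_a = 1[a present] - p^(e_H - e_G).  Everything rests on one estimate: for
    a bounded set F of edges,
      sum over copies a meeting F of p^|a \ F| <= K,  K = O(mu / Phi),
    which follows by grouping the copies according to the subgraph J of H landing in F, as
    extending a given copy of J costs mu_H / mu_J <= mu / Phi.

    1-statement.  E D^(2m) = O(mu^(2m) / Phi^m): only tuples of copies in which no copy is
    disjoint from all the others contribute.  Reading such a tuple in order, each copy
    disjoint from the earlier ones costs mu, any other one costs mu / Phi; a copy cannot be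
    disjoint both from its predecessors and from its successors, so one of the two reading
    directions has at most m copies of the first kind.  Since eps^2 Phi >= n^c, Markov's
    inequality beats the union bound over the n^g root tuples once m is large.

    0-statement.  One root tuple suffices.  Var D >= const mu^2 / Phi, so eps mu = o(sd D), and
    it remains to see that D is not concentrated on a scale s << sd D.  This is Stein's
    method with the explicit test function f(w) = w / (s + |w|): E[D f(D)] <= E|D|, whereas
    the local dependence of the xi_a gives E[D f(D)] ~ Var D * E f'(D), and f' >= 1/(4s)
    on [-s, s]. *)

(** * The product measure *)

Section ProductMeasure.
Variables (R : realType) (n : nat) (p : R).
Implicit Types (S A : {set edge n}) (f h : {set edge n} -> R).
Local Notation "''EE' f" := (Ex R n p f) (at level 10, f at level 8).

Lemma gnp_w_prod S :
  gnp_w R n p S = \prod_(t : edge n) (if t \in S then p else 1 - p).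
Proof.
rewrite (bigID (mem S)) /= (eq_bigr (fun=> p)); last by move=> i ->.
rewrite [X in _ * X](eq_bigr (fun=> 1 - p)); last by move=> i /negPf ->.
rewrite !prodr_const /gnp_w; congr (_ ^+ _ * _ ^+ _).
by rewrite cardsT -(cardsC S) addKn; apply: eq_card => i; rewrite !inE.
Qed.

Lemma gnp_w_setU1 (t : edge n) S : t \notin S ->
  p * gnp_w R n p S = (1 - p) * gnp_w R n p (t |: S).
Proof.
move=> tS; rewrite !gnp_w_prod (bigD1 t) //= [in RHS](bigD1 t) //=.
rewrite (negPf tS) setU11 mulrCA; congr (_ * (_ * _)).
by apply: eq_bigr => i it; rewrite in_setU1 (negPf it).
Qed.

Lemma sum_set_setU1 (t : edge n) (F : {set edge n} -> R) :
  \sum_S F S = \sum_(S : {set edge n} | t \notin S) (F S + F (t |: S)).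
Proof.
rewrite (bigID (fun S : {set edge n} => t \in S)) /= addrC big_split /=; congr (_ + _).
rewrite (reindex_onto (fun S => t |: S) (fun S => S :\ t)) /=; last first.
  by move=> S tS; rewrite setD1K.
apply: eq_bigl => S; rewrite setU11 /=; apply/eqP/idP => [<-|tS].
  by rewrite setD11.
by rewrite setU1K.
Qed.

Lemma eq_Ex f h : f =1 h -> 'EE f = 'EE h.
Proof. by move=> fh; apply: eq_bigr => S _; rewrite fh. Qed.

(** Sets S avoiding [t] are paired with [t |: S]. Their weights are compared without dividing by p
    or 1 - p, so that p = 0 and p = 1 are covered. *)
Lemma Ex_cond (t : edge n) h :
  'EE h = p * 'EE (fun S => h (t |: S)) + (1 - p) * 'EE (fun S => h (S :\ t)).
Proof.
rewrite /Ex !(sum_set_setU1 t) !mulr_sumr -big_split /=.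
apply: eq_bigr => S tS.
have tSD : S :\ t = S.
  by apply/setP => i; rewrite !inE; case: eqP => // ->; rewrite (negPf tS).
rewrite setUA setUid setU1K // tSD.
have := gnp_w_setU1 tS; set u := gnp_w _ _ _ _; set v := gnp_w _ _ _ (_ |: _).
by move=> uv; ring: uv.
Qed.

Lemma Ex_cst (c : R) : 'EE (fun=> c) = c.
Proof.
rewrite /Ex -mulr_suml (eq_bigr _ (fun S _ => gnp_w_prod S)).
have := @bigA_distr R 0 1 *%R +%R _ (fun t : edge n => p) (fun=> 1 - p).
rewrite /= => <-.
by rewrite big1 ?mul1r // => t _; rewrite addrC subrK.
Qed.

Lemma ExD f h : 'EE (fun S => f S + h S) = 'EE f + 'EE h.
Proof. by rewrite /Ex -big_split; apply: eq_bigr => S _; rewrite mulrDr. Qed.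

Lemma ExZ c f : 'EE (fun S => c * f S) = c * 'EE f.
Proof. by rewrite /Ex mulr_sumr; apply: eq_bigr => S _; rewrite mulrCA. Qed.

Lemma ExB f h : 'EE (fun S => f S - h S) = 'EE f - 'EE h.
Proof.
rewrite ExD -[- 'EE h]mulN1r -ExZ; congr (_ + _).
by apply: eq_Ex => S; rewrite mulN1r.
Qed.

Lemma Ex_sum (I : Type) (r : seq I) (P : pred I) (F : I -> {set edge n} -> R) :
  'EE (fun S => \sum_(i <- r | P i) F i S) = \sum_(i <- r | P i) 'EE (F i).
Proof.
rewrite /Ex exchange_big /=; apply: eq_bigr => S _.
by rewrite mulr_sumr.
Qed.

(** The edges of A are revealed one at a time by [Ex_cond]: each affects only f, and once A is
    exhausted f is constant. *)
Lemma Ex_indep A f h : (forall S, f (S :&: A) = f S) ->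
  (forall S, h (S :\: A) = h S) -> 'EE (fun S => f S * h S) = 'EE f * 'EE h.
Proof.
have [m] := ubnP #|A|; elim: m A f => // m IH A f.
have [->|[t tA]] := set_0Vmem A => leA fA hA.
  have fc S : f S = f finset.set0 by rewrite -fA finset.setI0.
  rewrite (eq_Ex (h := fun S => f finset.set0 * h S)); last by move=> S; rewrite fc.
  by rewrite ExZ (eq_Ex fc) Ex_cst.
have ht S : h (t |: S) = h S.
  rewrite -(hA (t |: S)) -[RHS]hA; congr h; apply/setP => i; rewrite !inE.
  by case: eqP => // ->; rewrite tA.
have ht' S : h (S :\ t) = h S.
  rewrite -(hA (S :\ t)) -[RHS]hA; congr h; apply/setP => i; rewrite !inE.
  by case: eqP => // ->; rewrite tA.
have lt : (#|A :\ t| < m)%N by rewrite (cardsD1 t) tA in leA.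
have hA' S : h (S :\: (A :\ t)) = h S.
  rewrite -[RHS]hA -[LHS]ht'; congr h; apply/setP => i; rewrite !inE.
  by case: eqP => [->|]; rewrite ?tA.
rewrite (Ex_cond t) [in RHS](Ex_cond t f).
under eq_Ex => S do rewrite ht.
under [X in _ + (_ * X)]eq_Ex => S do rewrite ht'.
rewrite (IH (A :\ t) (fun S => f (t |: S))) //; last first.
  move=> S; rewrite -fA -[RHS]fA; congr f; apply/setP => i; rewrite !inE.
  by case: eqP => //=; case: (i \in A) => //; rewrite ?andbT ?andbF.
rewrite (IH (A :\ t) (fun S => f (S :\ t))) //; last first.
  move=> S; rewrite -fA -[RHS]fA; congr f; apply/setP => i; rewrite !inE.
  by case: eqP => //=; case: (i \in A) => //; rewrite ?andbT ?andbF.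
by rewrite [RHS]mulrDl !mulrA.
Qed.

Definition ind A S : R := (A \subset S)%:R.

Lemma indM A A' S : ind A S * ind A' S = ind (A :|: A') S.
Proof. by rewrite /ind finset.subUset -natrM mulnb. Qed.

Lemma ind_invariant A S : ind A (S :&: A) = ind A S.
Proof. by rewrite /ind subsetI subxx andbT. Qed.

Lemma Ex_ind A : 'EE (ind A) = p ^+ #|A|.
Proof.
have [m] := ubnP #|A|; elim: m A => // m IH A.
have [->|[t tA]] := set_0Vmem A => leA.
  rewrite (eq_Ex (h := fun=> 1)) ?Ex_cst ?cards0 // => S.
  by rewrite /ind finset.sub0set.
rewrite (cardsD1 t) tA in leA *; rewrite (Ex_cond t) exprS.
rewrite (eq_Ex (h := ind (A :\ t))) ?IH //; last first.
  by move=> S; rewrite /ind subDset.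
rewrite [X in _ + _ * X](eq_Ex (h := fun=> 0)) ?Ex_cst ?mulr0 ?addr0 // => S.
by rewrite /ind; case E: (A \subset _) => //; move/subsetP: E => /(_ _ tA); rewrite !inE eqxx.
Qed.

Hypothesis p01 : 0 <= p <= 1.

Lemma gnp_w_ge0 S : 0 <= gnp_w R n p S.
Proof. by case/andP: p01 => p0 p1; rewrite mulr_ge0 ?exprn_ge0 ?subr_ge0. Qed.

Lemma le_Ex f h : (forall S, f S <= h S) -> 'EE f <= 'EE h.
Proof. by move=> fh; apply: ler_sum => S _; rewrite ler_wpM2l ?gnp_w_ge0. Qed.

Lemma Ex_ge0 f : (forall S, 0 <= f S) -> 0 <= 'EE f.
Proof. by move=> f0; apply: sumr_ge0 => S _; rewrite mulr_ge0 ?gnp_w_ge0. Qed.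

Lemma ler_norm_Ex f : `|'EE f| <= 'EE (fun S => `|f S|).
Proof.
apply: le_trans (ler_norm_sum _ _ _) _; apply: ler_sum => S _.
by rewrite normrM (ger0_norm (gnp_w_ge0 S)).
Qed.

Lemma PrE (A : pred {set edge n}) : Pr R n p A = 'EE (fun S => (A S)%:R).
Proof.
rewrite /Pr /Ex big_mkcond; apply: eq_bigr => S _.
by case: (A S); rewrite ?mulr1 ?mulr0.
Qed.

End ProductMeasure.

Arguments eq_Ex {R n p} [f h].
Arguments Ex_indep {R n p} A [f h].

(** * Sums of centred indicators *)

Lemma disjoint_setUl (T : finType) (A B C : {set T}) :
  [disjoint A :|: B & C] = [disjoint A & C] && [disjoint B & C].
Proof. by rewrite !disjoints_subset finset.subUset. Qed.

Lemma disjoint_setUr (T : finType) (A B C : {set T}) :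
  [disjoint A & B :|: C] = [disjoint A & B] && [disjoint A & C].
Proof. by rewrite ![[disjoint A & _]]disjoint_sym disjoint_setUl. Qed.

Lemma cardsUD (T : finType) (A F : {set T}) : #|A :|: F| = (#|A :\: F| + #|F|)%N.
Proof.
by rewrite -(cardsID F (A :|: F)) finset.setIC finset.setKU addnC finset.setDUl finset.setDv finset.setU0.
Qed.

(** * Sums over tuples of indices *)

Section TupleSum.
Variables (R : realType) (I : finType) (A : pred I).
Implicit Types (N : nat) (s : seq I) (h : seq I -> R).

(** Iterated sums rather than a sum over a tuple type: peeling off the first entry, which is how
    tuples of copies are read, is then plain computation. *)
Fixpoint tsum N h : R :=
  if N is N'.+1 then \sum_(i | A i) tsum N' (fun s => h (i :: s)) else h [::].

Lemma le_tsum N h h' : (forall s, size s = N -> all A s -> h s <= h' s) ->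
  tsum N h <= tsum N h'.
Proof.
elim: N h h' => [|N IH] h h' hh /=; first exact: hh.
apply: ler_sum => i Ai; apply: IH => s sN As.
by apply: hh => /=; rewrite ?sN ?Ai.
Qed.

Lemma eq_tsum N h h' : (forall s, h s = h' s) -> tsum N h = tsum N h'.
Proof.
by move=> hh; apply/eqP; rewrite eq_le !le_tsum // => s _ _; rewrite hh.
Qed.

Lemma tsumZ N c h : tsum N (fun s => c * h s) = c * tsum N h.
Proof.
elim: N h => //= N IH h; rewrite mulr_sumr.
by apply: eq_bigr => i _; rewrite IH.
Qed.

Lemma tsumD N h h' : tsum N (fun s => h s + h' s) = tsum N h + tsum N h'.
Proof.
elim: N h h' => //= N IH h h'; rewrite -big_split.
by apply: eq_bigr => i _; rewrite IH.
Qed.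

Lemma tsum_sum N (F : I -> seq I -> R) :
  tsum N (fun s => \sum_(i | A i) F i s) = \sum_(i | A i) tsum N (F i).
Proof.
elim: N F => //= N IH F; rewrite exchange_big /=.
by apply: eq_bigr => i _; rewrite IH.
Qed.

(** Peeling off the last entry instead of the first gives the same sum; this lets a tuple of copies
    be read backwards. *)
Lemma tsum_rev N h : tsum N (fun s => h (rev s)) = tsum N h.
Proof.
have rc M (h' : seq I -> R) : tsum M.+1 h' = tsum M (fun s => \sum_(i | A i) h' (rcons s i)).
  elim: M h' => //= M IH h'; apply: eq_bigr => i _.
  exact: (IH (fun s => h' (i :: s))).
elim: N h => // N IH h; rewrite rc tsum_sum /=.
apply: eq_bigr => i _; rewrite -(IH (fun s => h (i :: s))).
by apply: eq_tsum => s; rewrite rev_rcons.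
Qed.

Lemma exp_sum_tsum N (F : I -> R) :
  (\sum_(i | A i) F i) ^+ N = tsum N (fun s => \prod_(i <- s) F i).
Proof.
elim: N => [|N IH] /=; first by rewrite big_nil.
rewrite exprS IH mulr_suml; apply: eq_bigr => i _.
by rewrite -tsumZ; apply: eq_tsum => s; rewrite big_cons.
Qed.

Lemma Ex_tsum n (p : R) N (F : seq I -> {set edge n} -> R) :
  Ex R n p (fun S => tsum N (fun s => F s S)) = tsum N (fun s => Ex R n p (F s)).
Proof.
elim: N F => //= N IH F; rewrite Ex_sum.
by apply: eq_bigr => i _; rewrite (IH (fun s => F (i :: s))).
Qed.

End TupleSum.

Arguments eq_tsum {R I A N} [h h'].

(** * The test function of Stein's method *)

Section SteinFunction.
Variable R : realType.
Implicit Types a b s w : R.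

(* Bounded by 1, with a nonnegative Lipschitz derivative [dstein s] that is at least
   1 / (4 s) on [-s, s]. *)
Definition stein s w : R := w / (s + `|w|).
Definition dstein s w : R := s / (s + `|w|) ^+ 2.

(** Second-order remainder: w / (1 + |w|) has derivative 1 / (1 + |w|)^2, which is Lipschitz with
    constant 2. The bound is checked algebraically, according to the sign of b. *)
Let stein1_ge0 a b : 0 <= a -> 
  `|stein 1 a - stein 1 b - dstein 1 a * (a - b)| <= (a - b) ^+ 2.
Proof.
move=> a0; rewrite /stein /dstein (ger0_norm a0).
have a1 : 0 < 1 + a by lra.
have [b0|b0] := leP 0 b.
  rewrite (ger0_norm b0); have b1 : 0 < 1 + b by lra.
  have -> : a / (1 + a) - b / (1 + b) - 1 / (1 + a) ^+ 2 * (a - b) =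
     (a - b) ^+ 2 / ((1 + a) ^+ 2 * (1 + b)).
    by field; rewrite !gt_eqF.
  rewrite ger0_norm; last by rewrite divr_ge0 ?sqr_ge0 // mulr_ge0 ?sqr_ge0 // ltW.
  rewrite ler_pdivrMr; last by rewrite mulr_gt0 ?exprn_gt0.
  by rewrite ler_peMr ?sqr_ge0 // mulr_ege1 ?exprn_ege1 //; lra.
rewrite (ltr0_norm b0); have b1 : 0 < 1 - b by lra.
set c := - b; have -> : b = - c by rewrite opprK.
have c0 : 0 < c by rewrite oppr_gt0.
have c1 : 0 < 1 + c by lra.
have -> : a / (1 + a) - - c / (1 + c) - 1 / (1 + a) ^+ 2 * (a + c) =
   (a ^+ 2 + 2 * a * c + 2 * a ^+ 2 * c - c ^+ 2) / ((1 + a) ^+ 2 * (1 + c)).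
  by field; rewrite !gt_eqF.
have d0 : 0 < (1 + a) ^+ 2 * (1 + c) by rewrite mulr_gt0 ?exprn_gt0.
rewrite normrM normfV (gtr0_norm d0) ler_pdivrMr //.
have ac : 0 <= a * c by rewrite mulr_ge0 // ltW.
apply: (@le_trans _ _ ((a + c) ^+ 2 * (1 + 2 * a))).
  rewrite ler_norml; apply/andP; split; rewrite -subr_ge0.
    rewrite (_ : _ - _ = 2 * a ^+ 2 + 4 * (a * c) + 2 * a * a ^+ 2 + 6 * a * (a * c) + 2 * (a * c) * c); last by ring.
    by rewrite !addr_ge0 // ?mulr_ge0 // ?sqr_ge0 // ltW.
  rewrite (_ : _ - _ = 2 * c ^+ 2 + 2 * a * a ^+ 2 + 2 * a * (a * c) + 2 * (a * c) * c); last by ring.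
  by rewrite !addr_ge0 // ?mulr_ge0 // ?sqr_ge0 // ltW.
rewrite ler_wpM2l ?sqr_ge0 //.
rewrite -subr_ge0 (_ : _ - _ = a ^+ 2 + c * (1 + a) ^+ 2); last by ring.
by rewrite addr_ge0 ?sqr_ge0 // mulr_ge0 ?sqr_ge0 // ltW.
Qed.

(** Scaling by s reduces to s = 1, and oddness of the function to a >= 0. *)
Lemma stein_taylor s a b : 0 < s ->
  `|stein s a - stein s b - dstein s a * (a - b)| <= (a - b) ^+ 2 / s ^+ 2.
Proof.
move=> s0.
have n0 w : s + `|w| != 0 by rewrite gt_eqF // ltr_wpDr.
have n1 w : 1 + `|w| / s != 0.
  by rewrite gt_eqF // ltr_wpDr // divr_ge0 ?normr_ge0 ?ltW.
have nE w : `|w / s| = `|w| / s by rewrite normrM normfV (gtr0_norm s0).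
have fE w : stein s w = stein 1 (w / s).
  by rewrite /stein nE; field; rewrite n0 gt_eqF.
have dE w x : dstein s w * x = dstein 1 (w / s) * (x / s).
  by rewrite /dstein nE; field; rewrite n0 gt_eqF.
rewrite !fE dE mulrBl -expr_div_n mulrBl.
move: (a / s) (b / s) => {n0 n1 nE fE dE} {}a {}b.
have [a0|a0] := leP 0 a; first exact: stein1_ge0.
have := @stein1_ge0 (- a) (- b) _; rewrite /stein /dstein !normrN oppr_ge0 => /(_ (ltW a0)).
rewrite (_ : (- a - - b) ^+ 2 = (a - b) ^+ 2); last by ring.
by apply: le_trans; rewrite -[leLHS]normrN le_eqVlt; apply/orP; left; apply/eqP; congr (`| _ |); ring.
Qed.

Lemma norm_stein_le1 s w : 0 < s -> `|stein s w| <= 1.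
Proof.
move=> s0; have d0 : 0 < s + `|w| by rewrite ltr_wpDr.
by rewrite normrM normfV (gtr0_norm d0) ler_pdivrMr // mul1r ler_wpDl // ltW.
Qed.

Lemma dstein_ge0 s w : 0 < s -> 0 <= dstein s w.
Proof. by move=> s0; rewrite divr_ge0 ?sqr_ge0 // ltW. Qed.

Lemma dstein_le s w : 0 < s -> dstein s w <= s^-1.
Proof.
move=> s0; have d0 : 0 < s + `|w| by rewrite ltr_wpDr.
rewrite ler_pdivrMr ?exprn_gt0 // mulrC ler_pdivlMr // -expr2.
by rewrite ler_pXn2r ?nnegrE ?lerDl ?(ltW s0) ?(ltW d0).
Qed.

Lemma dstein_ge s w : 0 < s -> (`|w| <= s)%R%:R / (4 * s) <= dstein s w.
Proof.
move=> s0; have d0 : 0 < s + `|w| by rewrite ltr_wpDr.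
case: (leP `|w| s) => [ws|_]; last by rewrite mul0r dstein_ge0.
rewrite mul1r ler_pdivlMr ?exprn_gt0 // mulrC ler_pdivrMr ?mulr_gt0 //.
rewrite mulrCA -expr2 (_ : 4 * s ^+ 2 = (s + s) ^+ 2); last by ring.
by rewrite ler_pXn2r ?nnegrE ?lerD2l ?(ltW d0) ?addr_ge0 ?(ltW s0).
Qed.

End SteinFunction.

(** * Even moments of a sum of centred indicators *)

Section Dissociated.
Variables (R : realType) (n : nat) (p : R) (p01 : 0 <= p <= 1).
Variables (I : finType) (A : pred I) (a : I -> {set edge n}) (e B : nat) (K : R).
Hypothesis card_a : forall i, A i -> #|a i| = e.
Hypothesis leK : forall F : {set edge n}, (#|F| <= B)%N ->
  \sum_(i | A i && ~~ [disjoint a i & F]) p ^+ #|a i :\: F| <= K.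
Local Notation "''EE' f" := (Ex R n p f) (at level 10, f at level 8).
Implicit Types (S F : {set edge n}) (i j : I) (s : seq I).

Definition xi i S : R := ind R (a i) S - p ^+ e.
(* Dominates [`|xi i|] and, unlike it, expands into indicators with nonnegative weights. *)
Definition axi i S : R := ind R (a i) S + p ^+ e.
Definition dev S : R := \sum_(i | A i) xi i S.
Definition mean : R := \sum_(i | A i) p ^+ e.
Definition supp s : {set edge n} := \bigcup_(i <- s) a i.

Let p0 : 0 <= p. Proof. by case/andP: p01. Qed.
Let p1 : p <= 1. Proof. by case/andP: p01. Qed.

Lemma ler_norm_xi i S : `|xi i S| <= axi i S.
Proof.
apply: le_trans (ler_normB _ _) _.
by rewrite ger0_norm ?ler0n // ger0_norm ?exprn_ge0.
Qed.

Lemma supp_cons i s : supp (i :: s) = a i :|: supp s.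
Proof. by rewrite /supp big_cons. Qed.

Lemma supp_cat s s' : supp (s ++ s') = supp s :|: supp s'.
Proof. by rewrite /supp big_cat. Qed.

Lemma supp_rev s : supp (rev s) = supp s.
Proof.
elim: s => //= i s IH; rewrite rev_cons -cats1 supp_cat IH.
by rewrite !supp_cons /supp big_nil finset.setU0 finset.setUC.
Qed.

(** The product expands into 2 ^ size s terms. In each, replacing a constant p^e by the indicator of
    the e edges of [a i] can only increase the expectation, since these edges may overlap the
    others. F collects the indicators already chosen. *)
Lemma Ex_prod_axi F s : all A s ->
  'EE (fun S => ind R F S * \prod_(i <- s) axi i S)
    <= 2 ^+ size s * p ^+ #|F :|: supp s|.
Proof.
elim: s F => [|i s IH] F /=.
  move=> _; rewrite mul1r /supp big_nil finset.setU0 -Ex_ind.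
  by apply: le_Ex => // S; rewrite big_nil mulr1.
case/andP=> Ai As; rewrite supp_cons.
rewrite (eq_Ex (h := fun S => ind R (F :|: a i) S * \prod_(j <- s) axi j S
    + p ^+ e * (ind R F S * \prod_(j <- s) axi j S))); last first.
  by move=> S; rewrite big_cons -indM /axi; ring.
rewrite ExD ExZ exprS -mulrA mulr_natl mulr2n lerD //.
  by rewrite finset.setUA IH.
apply: le_trans (ler_wpM2l (exprn_ge0 _ p0) (IH F As)) _.
rewrite mulrCA ler_wpM2l ?exprn_ge0 // -exprD ler_wiXn2l //.
rewrite finset.setUCA (leq_trans (finset.leq_card_setU _ _)) //.
by rewrite card_a.
Qed.

Lemma Ex_prod_xi_le s : all A s ->
  `|'EE (fun S => \prod_(i <- s) xi i S)| <= 2 ^+ size s * p ^+ #|supp s|.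
Proof.
move=> As; apply: le_trans (ler_norm_Ex p01 _) _.
have := Ex_prod_axi finset.set0 As; rewrite finset.set0U; apply: le_trans.
apply: le_Ex => // S; rewrite /ind finset.sub0set mul1r normr_prod.
by apply: ler_prod => i _; rewrite normr_ge0 ler_norm_xi.
Qed.

Lemma Ex_xi_indep i (h : {set edge n} -> R) : A i ->
  (forall S, h (S :\: a i) = h S) -> 'EE (fun S => xi i S * h S) = 0.
Proof.
move=> Ai hi; rewrite (Ex_indep (a i)) //; last first.
  by move=> S; rewrite /xi ind_invariant.
by rewrite ExB Ex_ind Ex_cst card_a // subrr mul0r.
Qed.

Lemma xi_setD i F S : [disjoint a i & F] -> xi i (S :\: F) = xi i S.
Proof. by move=> d; rewrite /xi /ind finset.subsetD d andbT. Qed.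

Lemma prod_xi_setD s F S : [disjoint supp s & F] ->
  \prod_(i <- s) xi i (S :\: F) = \prod_(i <- s) xi i S.
Proof.
elim: s => [|i s IH]; first by rewrite !big_nil.
rewrite supp_cons !big_cons disjoint_setUl => /andP[d ds].
by rewrite xi_setD ?IH.
Qed.

(* The number of entries of [s] disjoint from [F] and from all earlier entries. *)
Fixpoint fresh F s : nat :=
  if s is i :: s' then ([disjoint a i & F] + fresh (a i :|: F) s')%N else 0%N.

Lemma fresh_rcons F s i :
  fresh F (rcons s i) = (fresh F s + [disjoint a i & (F :|: supp s)])%N.
Proof.
elim: s F => [|j s IH] F /=; first by rewrite /supp big_nil finset.setU0 addn0.
by rewrite IH addnA supp_cons finset.setUCA finset.setUA.
Qed.

(** An entry counted in both readings would be disjoint from F and from every other entry. F holds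
    the entries already read, as the induction requires. *)
Lemma fresh_add_rev F s :
  (forall s1 i s2, s = s1 ++ i :: s2 -> ~~ [disjoint a i & F :|: supp (s1 ++ s2)]) ->
  (fresh F s + fresh finset.set0 (rev s) <= size s)%N.
Proof.
elim: s F => [|i s IH] F H //=.
rewrite rev_cons fresh_rcons finset.set0U supp_rev.
have H1 := H [::] i s erefl; rewrite /= disjoint_setUr in H1.
have : (fresh (a i :|: F) s + fresh finset.set0 (rev s) <= size s)%N.
  apply: IH.
  move=> s1 j s2 E; have := H (i :: s1) j s2; rewrite E => /(_ erefl).
  by rewrite /= supp_cons finset.setUCA finset.setUA.
move: H1; by case: [disjoint _ & F]; case: [disjoint _ & supp s] => //= _; lia.
Qed.

(* With y = 1 / Phi, a fresh entry contributes y * mean and any other entry at most K. *)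
Lemma tsum_fresh_le y N F : 0 <= y -> (#|F| + N * e <= B)%N ->
  tsum A N (fun s => p ^+ #|F :|: supp s| * y ^+ fresh F s)
    <= p ^+ #|F| * (y * mean + K) ^+ N.
Proof.
move=> y0; elim: N F => [|N IH] F leB /=.
  by rewrite /supp big_nil finset.setU0 !mulr1.
have K0 : 0 <= y * mean + K.
  apply: addr_ge0; first by rewrite mulr_ge0 // sumr_ge0 // => i _; rewrite exprn_ge0.
  apply: le_trans (leK (F := finset.set0) _); last by rewrite cards0.
  by apply: sumr_ge0 => i _; rewrite exprn_ge0.
pose q i := p ^+ #|a i :\: F| * y ^+ [disjoint a i & F].
apply: (@le_trans _ _ (\sum_(i | A i) q i * (p ^+ #|F| * (y * mean + K) ^+ N))).
  apply: ler_sum => i Ai.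
  rewrite (eq_tsum (h' := fun s => y ^+ [disjoint a i & F] *
     (p ^+ #|(a i :|: F) :|: supp s| * y ^+ fresh (a i :|: F) s))); last first.
    by move=> s; rewrite supp_cons finset.setUCA finset.setUA exprD mulrCA.
  rewrite tsumZ /q [_ * y ^+ _]mulrC -mulrA ler_wpM2l ?exprn_ge0 //.
  have la : (#|a i :\: F| <= e)%N by rewrite -(card_a Ai) subset_leq_card ?subsetDl.
  apply: le_trans (IH _ _) _.
    by apply: leq_trans leB; rewrite cardsUD mulSn addnCA -addnA leq_add2r.
  by rewrite cardsUD exprD mulrA.
rewrite -mulr_suml [_ ^+ N.+1]exprS [leRHS]mulrCA ler_wpM2r //.
  by rewrite mulr_ge0 ?exprn_ge0.
rewrite (bigID (fun i => [disjoint a i & F])) /= lerD //.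
  rewrite /mean mulr_sumr big_mkcondr /=; apply: ler_sum => i Ai.
  case: ifP => [d|_]; last by rewrite mulr_ge0 ?exprn_ge0.
  by rewrite /q d expr1 mulrC (finset.setDidPl d) card_a.
apply: le_trans (leK (F := F) _); last by apply: leq_trans leB; rewrite leq_addr.
by apply: ler_sum => i /andP[_ /negPf d]; rewrite /q d mulr1.
Qed.

(** A tuple with nonzero expectation has at most m fresh entries in one of the two directions, so
    inserting the weight y^fresh there costs at most y^-m. Adding both directions gives the factor
    2, and 4^m = 2^(2m) comes from [Ex_prod_xi_le]. *)
Lemma moment_le (m : nat) y : 0 < y <= 1 -> (2 * m * e <= B)%N ->
  'EE (fun S => dev S ^+ (2 * m)) <= 2 * 4 ^+ m * y ^- m * (y * mean + K) ^+ (2 * m).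
Proof.
case/andP=> y0 y1 leB.
rewrite (eq_Ex (fun S => exp_sum_tsum A _ _)) Ex_tsum.
pose g s := p ^+ #|finset.set0 :|: supp s| * y ^+ fresh finset.set0 s.
have g0 s : 0 <= g s by rewrite mulr_ge0 ?exprn_ge0 // ltW.
apply: (@le_trans _ _ (tsum A (2 * m) (fun s => (4 ^+ m * y ^- m) * (g s + g (rev s))))).
  apply: le_tsum => s szs As.
  have [H|] := pselect (forall s1 i s2, s = s1 ++ i :: s2 ->
      ~~ [disjoint a i & finset.set0 :|: supp (s1 ++ s2)]); last first.
    (* An entry disjoint from all the others is centred and independent of them. *)
    move=> /existsNP[s1] /existsNP[i] /existsNP[s2] /not_implyP[Es /negP/negPn].
    rewrite finset.set0U disjoint_sym => d.
    rewrite (eq_Ex (h := fun S => xi i S * \prod_(j <- s1 ++ s2) xi j S)); last first.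
      by move=> S; rewrite Es !big_cat big_cons /= mulrCA.
    rewrite Ex_xi_indep.
    - by rewrite mulr_ge0 ?addr_ge0 // mulr_ge0 ?exprn_ge0 // invr_ge0 exprn_ge0 ?ltW.
    - by move: As; rewrite Es all_cat /= => /and3P[].
    - by move=> S; rewrite prod_xi_setD.
  have := fresh_add_rev H; rewrite szs => le2m.
  apply: le_trans (ler_norm _) _; apply: le_trans (Ex_prod_xi_le As) _.
  rewrite szs exprM -mulrA -natrX ler_wpM2l ?exprn_ge0 //.
  rewrite mulrC ler_pdivlMr ?exprn_gt0 //.
  have yle k : (k <= m)%N -> y ^+ m <= y ^+ k by move=> ?; rewrite ler_wiXn2l // ltW.
  have [lem|gtm] := leqP (fresh finset.set0 s) m.
    by rewrite -[leLHS]addr0 lerD // /g finset.set0U ler_wpM2l ?exprn_ge0 ?yle.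
  rewrite -[leLHS]add0r lerD // /g finset.set0U supp_rev ler_wpM2l ?exprn_ge0 ?yle //.
  by lia.
have := @tsum_fresh_le y (2 * m) finset.set0 (ltW y0).
rewrite cards0 mul1r => /(_ leB) le1.
rewrite tsumZ tsumD tsum_rev -mulr2n -[tsum _ _ _ *+ 2]mulr_natl mulrCA -!mulrA.
by rewrite !ler_wpM2l // ?invr_ge0 ?exprn_ge0 ?ltW.
Qed.

Let K0 : 0 <= K.
Proof.
apply: le_trans (leK (F := finset.set0) _); last by rewrite cards0.
by apply: sumr_ge0 => i _; rewrite exprn_ge0.
Qed.

(** * Stein's method and anticoncentration *)

Hypothesis leB : (4 * e <= B)%N.

Definition nbr i j := A j && ~~ [disjoint a j & a i].
Definition dev_near i S : R := \sum_(j | nbr i j) xi j S.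
(* Its mean is the variance of [dev]; it plays the role of the conditional variance in
   Stein's identity. *)
Definition qvar S : R := \sum_(i | A i) xi i S * dev_near i S.
Definition var : R := 'EE (fun S => dev S ^+ 2).

Lemma dev_far_setD i S : A i ->
  (dev (S :\: a i) - dev_near i (S :\: a i)) = dev S - dev_near i S.
Proof.
have E S' : dev S' - dev_near i S' =
    \sum_(j | A j && [disjoint a j & a i]) xi j S'.
  rewrite /dev (bigID (fun j => [disjoint a j & a i])) /= /dev_near /nbr.
  by rewrite addrK.
by move=> Ai; rewrite !E; apply: eq_bigr => j /andP[_ d]; rewrite xi_setD.
Qed.

(** In E D^2 = sum of E[xi_i D], the part of D far from i is independent of the centred xi_i and
    drops out. *)
Lemma Ex_qvar : 'EE qvar = var.
Proof.
rewrite /var [RHS](eq_Ex (h := fun S => \sum_(i | A i) xi i S * dev S)); last first.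
  by move=> S; rewrite /= expr2 {1}/dev mulr_suml.
rewrite /qvar !Ex_sum; apply: eq_bigr => i Ai; apply/esym/eqP.
rewrite -subr_eq0 -ExB (eq_Ex (h := fun S => xi i S * (dev S - dev_near i S))).
  by rewrite Ex_xi_indep // => S; rewrite dev_far_setD.
by move=> S; rewrite mulrBr.
Qed.

(** Let f = [stein s] and D_i = [dev_near i]. As xi_i is independent of D - D_i, E[D f(D)] is the
    sum of E[xi_i (f(D) - f(D - D_i))]. A Taylor expansion at D turns it into E[[qvar] f'(D)] up to
    the third term on the right; replacing [qvar] by its mean costs the second, since f' <= 1/s. *)
Lemma stein_bound (s : R) : 0 < s ->
  Pr R n p (fun S => `|dev S| <= s) * var / (4 * s) <=
  'EE (fun S => `|dev S|) + 'EE (fun S => `|qvar S - var|) / s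
   + (\sum_(i | A i) 'EE (fun S => `|xi i S| * dev_near i S ^+ 2)) / s ^+ 2.
Proof.
move=> s0; pose f := stein s; pose f' := dstein s.
have var0 : 0 <= var by apply: Ex_ge0 => // S; rewrite sqr_ge0.
have E1 : 'EE (fun S => dev S * f (dev S)) <= 'EE (fun S => `|dev S|).
  apply: le_Ex => // S; apply: le_trans (ler_norm _) _.
  by rewrite normrM ler_piMr // norm_stein_le1.
have E2 : 'EE (fun S => dev S * f (dev S)) =
    \sum_(i | A i) 'EE (fun S => xi i S * (f (dev S) - f (dev S - dev_near i S))).
  rewrite (eq_Ex (h := fun S => \sum_(i | A i) xi i S * f (dev S))); last first.
    by move=> S; rewrite {1}/dev mulr_suml.
  rewrite Ex_sum; apply: eq_bigr => i Ai.
  have <- : 'EE (fun S => xi i S * f (dev S)) -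
      'EE (fun S => xi i S * f (dev S - dev_near i S)) = 'EE (fun S => xi i S * f (dev S)).
    rewrite [X in _ - X]Ex_xi_indep ?subr0 // => S.
    by rewrite dev_far_setD.
  by rewrite -ExB; apply: eq_Ex => S; rewrite mulrBr.
have E3 : 'EE (fun S => qvar S * f' (dev S)) -
    (\sum_(i | A i) 'EE (fun S => `|xi i S| * dev_near i S ^+ 2)) / s ^+ 2
    <= 'EE (fun S => dev S * f (dev S)).
  rewrite E2 mulr_suml /qvar.
  rewrite (eq_Ex (h := fun S => \sum_(i | A i) xi i S * dev_near i S * f' (dev S))); last first.
    by move=> S; rewrite mulr_suml.
  rewrite Ex_sum -sumrB; apply: ler_sum => i Ai.
  rewrite mulrC -ExZ -ExB; apply: le_Ex => // S.
  have := stein_taylor (dev S) (dev S - dev_near i S) s0.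
  rewrite subKr -/f -/f'; set u := f _ - _; set v := f' _ * _ => le1.
  rewrite -mulrA [dev_near i S * _]mulrC -/v -subr_le0 addrAC -mulrBr subr_le0.
  apply: le_trans (ler_norm _) _; rewrite normrM mulrCA ler_wpM2l // distrC.
  by rewrite mulrC.
have E4 : Pr R n p (fun S => `|dev S| <= s) * var / (4 * s) <=
    'EE (fun S => qvar S * f' (dev S)) + 'EE (fun S => `|qvar S - var|) / s.
  rewrite PrE mulrAC [leLHS]mulrC [_ / s]mulrC [_ / (4 * s)]mulrC -!ExZ -ExD.
  apply: le_Ex => // S; set q := qvar S; set w := dev S.
  have h1 := dstein_ge w s0; have h2 := dstein_le w s0; have h3 := dstein_ge0 w s0.
  rewrite -/f' in h1 h2 h3.
  apply: (@le_trans _ _ (var * f' w)).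
    by rewrite ler_wpM2l // mulrC.
  rewrite -lerBlDl -mulrBl; apply: le_trans (ler_norm _) _.
  by rewrite normrM distrC mulrC ler_wpM2r // ger0_norm.
by move: E1 E3 E4; lra.
Qed.

(** This is [leK] multiplied by p^|F|: in a nested sum it removes the innermost index at the price
    of a factor K and leaves a power of the same shape. *)
Lemma sum_meet_le F (P : pred I) : (#|F| <= B)%N ->
  (forall k, P k -> A k && ~~ [disjoint a k & F]) ->
  \sum_(k | P k) p ^+ #|a k :|: F| <= K * p ^+ #|F|.
Proof.
move=> leF PA; apply: (@le_trans _ _ (\sum_(k | P k) p ^+ #|a k :\: F| * p ^+ #|F|)).
  by apply: ler_sum => k _; rewrite cardsUD exprD.
rewrite -mulr_suml ler_wpM2r ?exprn_ge0 //; apply: le_trans (leK leF).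
rewrite big_mkcond [leRHS]big_mkcond; apply: ler_sum => k _.
case: ifP => [/PA -> //|_]; case: ifP => // _; exact: exprn_ge0.
Qed.

(** The factor 8 = 2^3 comes from expanding three [axi] factors. The neighbours k and then j are
    summed out at cost K each, and i is left with total weight [mean]. *)
Lemma third_moment_le :
  \sum_(i | A i) 'EE (fun S => `|xi i S| * dev_near i S ^+ 2) <= 8 * mean * K ^+ 2.
Proof.
apply: (@le_trans _ _ (\sum_(i | A i) \sum_(j | nbr i j) \sum_(k | nbr i k)
    8 * p ^+ #|a k :|: (a j :|: a i)|)).
  apply: ler_sum => i Ai.
  apply: (@le_trans _ _ ('EE (fun S => \sum_(j | nbr i j) \sum_(k | nbr i k)
      (ind R finset.set0 S * \prod_(l <- [:: k; j; i]) axi l S)))).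
    apply: le_Ex => // S.
    rewrite -[dev_near i S ^+ 2]ger0_norm ?sqr_ge0 // normrX expr2.
    under eq_bigr => j _ do rewrite -mulr_sumr.
    apply: (@le_trans _ _ (axi i S * ((\sum_(j | nbr i j) axi j S) * (\sum_(j | nbr i j) axi j S)))).
      apply: ler_pM; rewrite ?mulr_ge0 ?ler_norm_xi //.
      have le1 : `|dev_near i S| <= \sum_(j | nbr i j) axi j S.
        apply: le_trans (ler_norm_sum _ _ _) _; apply: ler_sum => j _.
        exact: ler_norm_xi.
      by apply: ler_pM.
    rewrite mulr_suml mulr_sumr; apply: ler_sum => j _.
    rewrite /ind finset.sub0set mul1r mulr_sumr mulr_sumr; apply: ler_sum => k _.
    by rewrite !big_cons big_nil mulr1 [leLHS]mulrC -mulrA mulrCA mulrA mulrC.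
  rewrite Ex_sum; apply: ler_sum => j /andP[Aj _]; rewrite Ex_sum.
  apply: ler_sum => k /andP[Ak _].
  have := @Ex_prod_axi finset.set0 [:: k; j; i].
  rewrite /= Ai Aj Ak => /(_ isT); rewrite finset.set0U !supp_cons /supp big_nil finset.setU0.
  by rewrite -natrX.
rewrite -mulrA [mean * _]mulrC /mean mulr_sumr mulr_sumr; apply: ler_sum => i Ai.
under eq_bigr => j _ do rewrite -mulr_sumr.
rewrite -mulr_sumr ler_wpM2l // expr2 -mulrA -{1}(card_a Ai).
apply: (@le_trans _ _ (\sum_(j | nbr i j) K * p ^+ #|a j :|: a i|)).
  apply: ler_sum => j /andP[Aj _]; apply: sum_meet_le.
    have [le2 _] := leq_card_setU (a j) (a i).
    by rewrite (card_a Ai) (card_a Aj) in le2; lia.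
  by move=> k /andP[Ak]; rewrite disjoint_setUr negb_and Ak orbC /= => ->.
rewrite -mulr_sumr ler_wpM2l //; apply: sum_meet_le => //.
by rewrite card_a //; lia.
Qed.

Lemma nbr_sym i j : A i -> A j -> nbr i j = nbr j i.
Proof. by move=> Ai Aj; rewrite /nbr Ai Aj disjoint_sym. Qed.

(** If k meets F, sum out l, which meets k, and then k. If l meets F, exchange the two sums and use
    the symmetry of [nbr]. Each case gives K^2. *)
Lemma sum_pair_meet_le F : (#|F| + e <= B)%N ->
  \sum_(k | A k) \sum_(l | nbr k l) 
     (~~ [disjoint a k & F] || ~~ [disjoint a l & F])%:R * p ^+ #|a l :|: (a k :|: F)|
  <= 2 * K ^+ 2 * p ^+ #|F|.
Proof.
move=> leF.
pose g k l : R := (~~ [disjoint a k & F])%:R * p ^+ #|a l :|: (a k :|: F)|.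
have bound1 : \sum_(k | A k) \sum_(l | nbr k l) g k l <= K ^+ 2 * p ^+ #|F|.
  apply: (@le_trans _ _ (\sum_(k | A k && ~~ [disjoint a k & F]) K * p ^+ #|a k :|: F|)).
    rewrite [leRHS]big_mkcondr; apply: ler_sum => k Ak; rewrite -mulr_sumr.
    case: (boolP [disjoint a k & F]) => d /=; first by rewrite mul0r.
    rewrite mul1r; apply: sum_meet_le => [|l /andP[Al]].
      have [le2 _] := leq_card_setU (a k) F.
      by rewrite (card_a Ak) in le2; apply: leq_trans le2 _; rewrite addnC.
    by rewrite disjoint_setUr negb_and Al => ->.
  rewrite -mulr_sumr expr2 -mulrA ler_wpM2l //; apply: sum_meet_le => //.
  by apply: leq_trans leF; rewrite leq_addr.
have bound2 : \sum_(k | A k) \sum_(l | nbr k l) g l k <= K ^+ 2 * p ^+ #|F|.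
  apply: le_trans bound1; rewrite (exchange_big_dep A) /=; last by move=> k l _ /andP[].
  apply: ler_sum => l Al; rewrite big_mkcond [leRHS]big_mkcond.
  apply: ler_sum => k _; case: (boolP (A k)) => Ak /=; last first.
    by rewrite /nbr (negPf Ak).
  by rewrite nbr_sym.
rewrite -mulrA mulr_natl mulr2n; apply: le_trans (lerD bound1 bound2).
rewrite -big_split /=; apply: ler_sum => k Ak; rewrite -big_split /=.
apply: ler_sum => l _; rewrite /g [a k :|: (a l :|: F)]finset.setUCA -mulrDl.
rewrite ler_wpM2r ?exprn_ge0 // -natrD ler_nat.
by do 2 case: [disjoint _ & F].
Qed.

(** If neither k nor l meets F, the two products are independent. Otherwise each of the two terms is
    at most 16 p^|union| in absolute value: 16 = 2^4 for the four factors, and 16 = 4 * 4 for the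
    two pairs, whose exponents add up to at least the size of the union. *)
Lemma cov_pair_le i j k l : A i -> A j -> A k -> A l ->
  'EE (fun S => (xi i S * xi j S) * (xi k S * xi l S))
    - 'EE (fun S => xi i S * xi j S) * 'EE (fun S => xi k S * xi l S)
  <= 32 * ((~~ [disjoint a k & a j :|: a i] || ~~ [disjoint a l & a j :|: a i])%:R
       * p ^+ #|a l :|: (a k :|: (a j :|: a i))|).
Proof.
move=> Ai Aj Ak Al; set F := a j :|: a i.
have [d|nd] := boolP ([disjoint a k & F] && [disjoint a l & F]).
  rewrite (Ex_indep F).
  - by rewrite subrr -negb_and d mul0r mulr0.
  - move=> S; congr (_ * _); rewrite /xi /ind finset.subsetI ?subsetUr ?subsetUl andbT //.
  - by move=> S; case/andP: d => ? ?; rewrite !xi_setD.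
rewrite -negb_and nd mul1r.
have pair_le u v : A u -> A v -> `|'EE (fun S => xi u S * xi v S)| <= 4 * p ^+ #|a u :|: a v|.
  move=> Au Av; have := @Ex_prod_xi_le [:: u; v].
  rewrite /= Au Av -natrX !supp_cons /supp big_nil finset.setU0 => /(_ isT).
  by apply: le_trans; rewrite le_eqVlt; apply/orP; left; apply/eqP; congr (`| _ |);
    apply: eq_Ex => S; rewrite !big_cons big_nil mulr1.
have E4 : `|'EE (fun S => (xi i S * xi j S) * (xi k S * xi l S))|
    <= 16 * p ^+ #|a l :|: (a k :|: F)|.
  have := @Ex_prod_xi_le [:: l; k; j; i].
  rewrite /= Ai Aj Ak Al -natrX !supp_cons /supp big_nil finset.setU0 => /(_ isT).
  apply: le_trans; rewrite le_eqVlt; apply/orP; left; apply/eqP; congr (`| _ |).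
  by apply: eq_Ex => S; rewrite !big_cons big_nil mulr1; ring.
have E22 : `|'EE (fun S => xi i S * xi j S) * 'EE (fun S => xi k S * xi l S)|
    <= 16 * p ^+ #|a l :|: (a k :|: F)|.
  rewrite normrM; apply: le_trans (ler_pM _ _ (pair_le _ _ Ai Aj) (pair_le _ _ Ak Al)) _ => //.
  rewrite mulrACA -exprD -natrM ler_wpM2l // ler_wiXn2l // finset.setUA.
  rewrite [a l :|: a k]finset.setUC /F [a j :|: _]finset.setUC [_ :|: (a i :|: _)]finset.setUC.
  by have [] := leq_card_setU (a i :|: a j) (a k :|: a l).
move: E4 E22; rewrite !ler_norml => /andP[_ h1] /andP[h2 _].
apply: le_trans (lerB h1 h2) _; rewrite opprK -mulrDl -natrD.
exact: lexx.
Qed.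

(** The variance of [qvar] is a sum of covariances over quadruples. Summing out the pair (k, l)
    costs 32 * 2 K^2, then j costs K, and i leaves [mean]. *)
Lemma var_qvar_le : 'EE (fun S => (qvar S - var) ^+ 2) <= 64 * mean * K ^+ 3.
Proof.
have qE S : qvar S = \sum_(i | A i) \sum_(j | nbr i j) xi i S * xi j S.
  by apply: eq_bigr => i _; rewrite mulr_sumr.
have -> : 'EE (fun S => (qvar S - var) ^+ 2) = 'EE (fun S => qvar S * qvar S) - var * var.
  rewrite (eq_Ex (h := fun S => (qvar S * qvar S - var * qvar S) - (var * qvar S - var * var))).
    by rewrite !ExB !ExZ Ex_cst Ex_qvar subrr subr0.
  by move=> S; ring.
rewrite -Ex_qvar.
rewrite (eq_Ex (h := fun S => \sum_(i | A i) \sum_(j | nbr i j) \sum_(k | A k)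
   \sum_(l | nbr k l) (xi i S * xi j S) * (xi k S * xi l S))); last first.
  move=> S; rewrite {1}qE mulr_suml; apply: eq_bigr => i _.
  rewrite mulr_suml; apply: eq_bigr => j _; rewrite qE mulr_sumr.
  by apply: eq_bigr => k _; rewrite mulr_sumr.
rewrite (eq_Ex qE) !Ex_sum mulr_suml -sumrB.
apply: (@le_trans _ _ (\sum_(i | A i) \sum_(j | nbr i j) 32 * (2 * K ^+ 2 * p ^+ #|a j :|: a i|))).
  apply: ler_sum => i Ai; rewrite !Ex_sum mulr_suml -sumrB.
  apply: ler_sum => j /andP[Aj _].
  have [le2 _] := leq_card_setU (a j) (a i); rewrite (card_a Ai) (card_a Aj) in le2.
  have leF : (#|a j :|: a i| + e <= B)%N by lia.
  apply: (le_trans _ (ler_wpM2l (ler0n R 32) (sum_pair_meet_le leF))).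
  rewrite Ex_sum !mulr_sumr -sumrB.
  apply: ler_sum => k Ak; rewrite !Ex_sum !mulr_sumr -sumrB.
  by apply: ler_sum => l /andP[Al _]; apply: cov_pair_le.
apply: (@le_trans _ _ (\sum_(i | A i) 64 * K ^+ 2 * (K * p ^+ #|a i|))).
  apply: ler_sum => i Ai; rewrite -!mulr_sumr.
  rewrite (_ : 64 * _ * _ = 32 * (2 * K ^+ 2 * (K * p ^+ #|a i|))); last first.
    by move: (p ^+ _) => q; ring.
  rewrite !ler_wpM2l ?mulr_ge0 ?exprn_ge0 //; apply: sum_meet_le => //.
  by rewrite card_a //; lia.
rewrite -mulr_sumr (eq_bigr (fun=> p ^+ e * K)); last by move=> i Ai; rewrite card_a // mulrC.
rewrite -mulr_suml -/mean le_eqVlt; apply/orP; left; apply/eqP.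
by move: mean => q; ring.
Qed.

(** This is [stein_bound] at s = d t, t = sqrt(var), multiplied by 4 d / t. In the leading 6 d, the
    bound E|D| <= t accounts for 4 d, and the term d t^2 / 2 in the estimate of E|[qvar] - [var]|
    for 2 d. *)
Lemma anticoncentration (d : R) : 0 < var -> 0 < d ->
  Pr R n p (fun S => `|dev S| <= d * Num.sqrt var) <=
    6 * d + 128 * mean * K ^+ 3 / (d * Num.sqrt var ^+ 4)
      + 32 * mean * K ^+ 2 / (d * Num.sqrt var ^+ 3).
Proof.
move=> var_gt0 d0; set t := Num.sqrt var; have t0 : 0 < t by rewrite sqrtr_gt0.
have tt : var = t ^+ 2 by rewrite sqr_sqrtr // ltW.
(* Bounds a first absolute moment by a second moment, y being the order of magnitude aimed at. *)
have amgm (x y : R) : 0 < y -> `|x| <= (x ^+ 2 / y + y) / 2.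
  move=> y0; rewrite ler_pdivlMr // -(ler_pM2r y0) mulrDl divfK ?gt_eqF // -real_normK ?num_real //.
  rewrite -subr_ge0 (_ : _ - _ = (`|x| - y) ^+ 2) ?sqr_ge0 //; ring.
have E1 : 'EE (fun S => `|dev S|) <= t.
  apply: (@le_trans _ _ ('EE (fun S => t^-1 / 2 * dev S ^+ 2 + t / 2))).
    by apply: le_Ex => // S; apply: le_trans (amgm _ _ t0) _; rewrite le_eqVlt; apply/orP; left; apply/eqP; field; rewrite gt_eqF.
  rewrite ExD ExZ Ex_cst -/var tt le_eqVlt; apply/orP; left; apply/eqP; field.
  by rewrite gt_eqF.
have E2 : 'EE (fun S => `|qvar S - var|) <= 32 * mean * K ^+ 3 / (d * t ^+ 2) + d * t ^+ 2 / 2.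
  have y0 : 0 < d * t ^+ 2 by rewrite mulr_gt0 ?exprn_gt0.
  apply: (@le_trans _ _ ('EE (fun S => (d * t ^+ 2)^-1 / 2 * (qvar S - var) ^+ 2 + d * t ^+ 2 / 2))).
    by apply: le_Ex => // S; apply: le_trans (amgm _ _ y0) _; rewrite le_eqVlt; apply/orP; left; apply/eqP; field; rewrite !gt_eqF.
  rewrite ExD Ex_cst ExZ lerD2r.
  apply: (@le_trans _ _ ((d * t ^+ 2)^-1 / 2 * (64 * mean * K ^+ 3))).
    by rewrite ler_wpM2l ?var_qvar_le // divr_ge0 // invr_ge0 ltW.
  by rewrite le_eqVlt; apply/orP; left; apply/eqP; field; rewrite !gt_eqF.
have s0 : 0 < d * t by rewrite mulr_gt0.
have := stein_bound s0; set P := Pr _ _ _ _ => le1.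
have E3 : P * var / (4 * (d * t)) <=
    t + (32 * mean * K ^+ 3 / (d * t ^+ 2) + d * t ^+ 2 / 2) / (d * t) + 8 * mean * K ^+ 2 / (d * t) ^+ 2.
  apply: le_trans le1 _; rewrite !lerD // ler_pM2r ?invr_gt0 ?exprn_gt0 //.
  exact: third_moment_le.
have -> : P = P * var / (4 * (d * t)) * (4 * d / t).
  by rewrite tt; field; rewrite !gt_eqF.
apply: (@le_trans _ _ ((t + (32 * mean * K ^+ 3 / (d * t ^+ 2) + d * t ^+ 2 / 2) / (d * t) + 8 * mean * K ^+ 2 / (d * t) ^+ 2) * (4 * d / t))).
  by rewrite ler_wpM2r // divr_ge0 ?mulr_ge0 ?ltW.
by rewrite le_eqVlt; apply/orP; left; apply/eqP; field; rewrite !gt_eqF.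
Qed.

End Dissociated.

(** * Counting extensions *)

Lemma leq_card_fiber (T U : finType) (f : T -> U) (P : pred T) (Q : pred U) w :
  (forall t, P t -> Q (f t)) ->
  (forall u, Q u -> (#|[pred t | P t & f t == u]| <= w)%N) ->
  (#|P| <= #|Q| * w)%N.
Proof.
move=> PQ fib; rewrite -sum1_card (partition_big f Q) //=.
rewrite -sum_nat_const; apply: leq_sum => u Qu.
by rewrite sum1_card fib.
Qed.

Lemma ler_sum_image (R : realType) (T U : finType) (f : T -> U) (P : pred T)
    (Q : pred U) (G : U -> R) :
  (forall u, 0 <= G u) -> (forall u, Q u -> exists2 t, P t & f t = u) ->
  \sum_(u | Q u) G u <= \sum_(t | P t) G (f t).
Proof.
move=> G0 fQ; rewrite [leRHS](partition_big f xpredT) //=.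
rewrite big_mkcond; apply: ler_sum => u _.
case: ifP => [/fQ[t Pt ftu]|_]; last by rewrite sumr_ge0.
rewrite (bigD1 t) ?Pt ?ftu ?eqxx //= lerDl sumr_ge0 //.
Qed.

Lemma card_family_leq (m n w : nat) (F : 'I_m -> pred 'I_n) (W : {set 'I_m}) :
  (0 < w)%N -> (forall i, i \notin W -> (#|F i| <= w)%N) ->
  (#|(family F : simpl_pred {ffun 'I_m -> 'I_n})| <= w ^ m * n ^ #|W|)%N.
Proof.
move=> w0 Fw; rewrite card_family foldrE big_map big_enum /=.
have -> : (w ^ m * n ^ #|W| = \prod_(i : 'I_m) (w * if i \in W then n else 1))%N.
  by rewrite big_split /= prod_nat_const card_ord -big_mkcond prod_nat_const.
apply: leq_prod => i _; case: ifPn => [_|/Fw].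
  by rewrite -[leqLHS]mul1n leq_mul // -[leqRHS]card_ord max_card.
by rewrite muln1.
Qed.

Lemma expn_le_ffact (n g k : nat) : (2 * (g + k) <= n)%N ->
  (n ^ k <= 2 ^ k * (n - g) ^_ k)%N.
Proof.
elim: k g => // k IH g le; rewrite ffactnS !expnS mulnACA leq_mul //; first by lia.
by rewrite -subnS IH //; lia.
Qed.

(** * Copies of a subgraph J over a root tuple *)

Section Extensions.
Variables (g k n : nat).
Implicit Types (x y : {ffun 'I_g -> 'I_n}) (phi : {ffun 'I_(g + k) -> 'I_n}).
Implicit Types (V : {set 'I_(g + k)}) (E : {set {set 'I_(g + k)}}).
Local Notation copy := ({set 'I_n} * {set {set 'I_n}})%type.

(* E(J) \ E(G): the edges counted by e_J - e_G. *)
Definition new_edges E := E :\: root_edges g k E.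

Definition is_copy V E x : pred copy := fun C =>
  [exists phi, is_ext g k n V x phi && (C == copy_of g k n V E phi)].

(** Members of [C.2] that are not pairs are dropped; a copy of a graph has none ([copy_edge2]), so
    nothing is lost there. *)
Definition edge_set (C : copy) : {set edge n} := [set t | val t \in C.2].

Lemma is_extP V x phi :
  reflect ({in V &, injective phi} /\ forall i, phi (lshift k i) = x i)
    (is_ext g k n V x phi).
Proof.
apply: (iffP andP) => [[/'forall_implyP inj /forallP xE]|[inj xE]].
  split=> [u v uV vV /eqP uv|i]; last exact/eqP.
  by move/'forall_implyP: (inj _ uV) => /(_ _ vV)/implyP/(_ uv)/eqP.
split; last by apply/forallP => i; rewrite xE.
apply/'forall_implyP => u uV; apply/'forall_implyP => v vV; apply/implyP.
by move=> /eqP/inj->.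
Qed.

Lemma is_copyP V E x C :
  reflect (exists2 phi, is_ext g k n V x phi & C = copy_of g k n V E phi)
    (is_copy V E x C).
Proof.
apply: (iffP existsP) => [[phi /andP[h /eqP]]|[phi h ->]]; exists phi => //.
by rewrite h eqxx.
Qed.

Lemma mem_roots i : lshift k i \in Defs.roots g k.
Proof. exact: imset_f. Qed.

Lemma card_roots : #|Defs.roots g k| = g.
Proof. by rewrite card_imset ?card_ord //; apply: lshift_inj. Qed.

Lemma sub_edge_set (C : copy) : (forall f, f \in C.2 -> #|f| = 2%N) ->
  forall S : {set edge n}, (C.2 \subset edges_of n S) = (edge_set C \subset S).
Proof.
move=> C2 S; apply/fintype.subsetP/fintype.subsetP => [h t|h f fC].
  by rewrite inE => /h/imsetP[t' t'S /val_inj->].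
have f2 : #|f| == 2%N by rewrite C2.
by apply/imsetP; exists (Sub f f2) => //; apply: h; rewrite inE.
Qed.

Lemma card_edge_set (C : copy) : (forall f, f \in C.2 -> #|f| = 2%N) -> #|edge_set C| = #|C.2|.
Proof.
move=> C2; rewrite -(card_imset _ val_inj); apply: eq_card => f.
apply/imsetP/idP => [[t + ->]|fC]; first by rewrite inE.
have f2 : #|f| == 2%N by rewrite C2.
by exists (Sub f f2); rewrite ?inE.
Qed.

Section Fixed.
Variables (V : {set 'I_(g + k)}) (E : {set {set 'I_(g + k)}}).
Hypothesis rootsV : Defs.roots g k \subset V.
Hypothesis E2 : forall e, e \in E -> #|e| = 2%N.
Hypothesis EV : forall e, e \in E -> e \subset V.

Lemma new_edges_sub e : e \in new_edges E -> e \in E.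
Proof. by rewrite inE => /andP[]. Qed.

Lemma card_img x phi e : is_ext g k n V x phi -> e \in E -> #|img (g + k) n phi e| = 2%N.
Proof.
case/is_extP=> inj _ eE; rewrite card_in_imset ?E2 // => u v ue ve.
by apply: inj; apply: (fintype.subsetP (EV eE)).
Qed.

Lemma img_inj x phi : is_ext g k n V x phi -> {in E &, injective (img (g + k) n phi)}.
Proof.
case/is_extP=> inj _ e f eE fE ef; apply/setP => u.
have sub e' f' : e' \in E -> f' \in E -> img (g + k) n phi e' = img (g + k) n phi f' ->
    u \in e' -> u \in f'.
  move=> eE' fE' ef' ue; have : phi u \in img (g + k) n phi f' by rewrite -ef' imset_f.
  case/imsetP=> v vf /inj->//; first exact: (fintype.subsetP (EV eE')).
  exact: (fintype.subsetP (EV fE')).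
by apply/idP/idP; apply: sub.
Qed.

Lemma copy_edge2 x C : is_copy V E x C -> forall f, f \in C.2 -> #|f| = 2%N.
Proof.
case/is_copyP=> phi h -> f /imsetP[e /new_edges_sub eE ->]; exact: card_img h eE.
Qed.

Lemma card_edge_set_copy x C : is_copy V E x C -> #|edge_set C| = #|new_edges E|.
Proof.
move=> hC; rewrite (card_edge_set (copy_edge2 hC)).
case/is_copyP: hC => phi h ->; rewrite card_in_imset // => e f /new_edges_sub eE /new_edges_sub fE.
exact: img_inj h _ _ eE fE.
Qed.

Lemma Xext_sum (R : realType) x S :
  (Xext g k n V E x S)%:R = \sum_(C | is_copy V E x C) ind R (edge_set C) S.
Proof.
rewrite /Xext -sum1_card natr_sum [RHS](bigID (fun C => edge_set C \subset S)) /=.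
rewrite [X in _ + X]big1 ?addr0; last by move=> C /andP[_ /negPf]; rewrite /ind => ->.
apply: eq_big => [C|C]; last first.
  rewrite inE => /existsP[phi /and3P[h /eqP CE sub]].
  have hC : is_copy V E x C by apply/is_copyP; exists phi.
  by rewrite /ind -(sub_edge_set (copy_edge2 hC)) sub.
rewrite inE; apply/existsP/andP => [[phi /and3P[h /eqP CE sub]]|[hC sub]].
  have hC : is_copy V E x C by apply/is_copyP; exists phi.
  by split=> //; rewrite -(sub_edge_set (copy_edge2 hC)).
have [phi h CE] := is_copyP _ _ _ _ hC; exists phi.
by rewrite h CE eqxx -CE (sub_edge_set (copy_edge2 hC)).
Qed.

Lemma Ex_Xext (R : realType) (p : R) x :
  Ex R n p (fun S => (Xext g k n V E x S)%:R) = #|is_copy V E x|%:R * p ^+ #|new_edges E|.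
Proof.
rewrite (eq_Ex (fun S => Xext_sum R x S)) Ex_sum mulr_natl -sumr_const.
by apply: eq_bigr => C hC; rewrite Ex_ind (card_edge_set_copy hC).
Qed.

End Fixed.

(** The permutation s maps the copies over x injectively to copies over y. *)
Lemma card_is_copy_leq V E x y (s : {perm 'I_n}) :
  (forall i, s (x i) = y i) -> (#|is_copy V E x| <= #|is_copy V E y|)%N.
Proof.
move=> sxy.
pose F (C : copy) : copy := (s @: C.1, [set s @: (f : {set 'I_n}) | f in C.2]).
have Finj : injective F.
  move=> [C1 C2] [D1 D2] [] /(imset_inj (@perm_inj _ s)) -> h; congr (_, _).
  by apply: imset_inj h; apply: imset_inj; apply: perm_inj.
rewrite -(card_image Finj); apply/subset_leq_card/fintype.subsetP => C /imageP[D hD ->].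
have [phi h ->] := is_copyP _ _ _ _ hD; have [inj xE] := is_extP _ _ _ h.
apply/is_copyP; exists [ffun i => s (phi i)].
  apply/is_extP; split=> [u v uV vV|i]; rewrite !ffunE; last by rewrite xE sxy.
  by move/perm_inj; apply: inj.
rewrite /F /copy_of /=; congr (_, _).
  by rewrite -imset_comp; apply: eq_imset => i; rewrite ffunE.
rewrite -imset_comp; apply: eq_imset => e; rewrite /img /= -imset_comp.
by apply: eq_imset => i; rewrite ffunE.
Qed.

(** The symmetric group is n-transitive, hence g-transitive for g <= n, which the injection x
    ensures. *)
Lemma exists_perm_extend x y : injective x -> injective y ->
  exists s : {perm 'I_n}, forall i, s (x i) = y i.
Proof.
move=> xinj yinj.
have len : (g <= #|'I_n|)%N by rewrite -[leqLHS]card_ord; apply: leq_card xinj.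
have tr := ntransitive_weak len (Sym_trans 'I_n).
have dt (z : {ffun 'I_g -> 'I_n}) : injective z -> [tuple z i | i < g] \in g.-dtuple([set: 'I_n]).
  move=> zi; apply/dtuple_onP; split=> [i j|i]; last by rewrite inE.
  by rewrite !tnth_mktuple; apply: zi.
have := atransP2 tr (dt _ xinj) (dt _ yinj) => -[s _ h].
exists s => i; have := congr1 (fun t => tnth t i) h.
by rewrite tnth_mktuple tnth_map tnth_mktuple => ->.
Qed.

Lemma card_is_copy_eq V E x y : injective x -> injective y ->
  #|is_copy V E x| = #|is_copy V E y|.
Proof.
move=> xi yi; apply/eqP; rewrite eqn_leq.
have [s hs] := exists_perm_extend xi yi; have [t ht] := exists_perm_extend yi xi.
by rewrite (card_is_copy_leq V E hs) (card_is_copy_leq V E ht).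
Qed.

(** Although [mu] is defined through one picked root tuple, by symmetry every injective x gives the
    same value. *)
Lemma mu_copies (R : realType) (p : R) V E x :
  Defs.roots g k \subset V -> (forall e, e \in E -> #|e| = 2%N) ->
  (forall e, e \in E -> e \subset V) -> injective x ->
  mu R g k n p V E = #|is_copy V E x|%:R * p ^+ #|new_edges E|.
Proof.
move=> rV E2 EV xi; rewrite /mu; case: pickP => [y /injectiveP yi|/(_ x)/injectiveP//].
by rewrite Ex_Xext // (card_is_copy_eq _ _ yi xi).
Qed.

End Extensions.

(* n ^ (v_J - v_G) is at most [copy_const g k] times the number of copies of J: 2 ^ k bounds
   n ^ k / (n - g)_k and the other factor the number of embeddings with a given image. *)
Definition copy_const (g k : nat) : nat := (2 ^ k * (g + k) ^ (g + k))%N.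

(** * The number of copies of J is n^(v_J - v_G) up to constants *)

Section Counting.
Variables (g k n : nat) (x : {ffun 'I_g -> 'I_n}).
Hypothesis x_inj : injective x.
Hypothesis n_gt0 : (0 < n)%N.
Implicit Types (phi : {ffun 'I_(g + k) -> 'I_n}).
Implicit Types (V W : {set 'I_(g + k)}) (E : {set {set 'I_(g + k)}}).

Definition base (i : 'I_(g + k)) : 'I_n :=
  match split i with inl a => x a | inr _ => Ordinal n_gt0 end.

(** With a default vertex outside W, two restrictions are equal exactly when the maps agree on W. *)
Definition restr W phi : {ffun 'I_(g + k) -> 'I_n} :=
  [ffun i => if i \in W then phi i else Ordinal n_gt0].

Definition restr_range W : pred {ffun 'I_(g + k) -> 'I_n} :=
  family (fun i => if i \in W :\: Defs.roots g k then predT else pred1 (base i)).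

Lemma card_restr_range W : (#|restr_range W| <= n ^ #|W :\: Defs.roots g k|)%N.
Proof.
apply: leq_trans (card_family_leq (w := 1) (W := W :\: Defs.roots g k) _ _) _ => //.
  by move=> i /negPf ->; rewrite card1.
by rewrite exp1n mul1n.
Qed.

Lemma restr_in_range W phi : Defs.roots g k \subset W ->
  (forall i, phi (lshift k i) = x i) -> restr_range W (restr W phi).
Proof.
move=> rW phix; apply/familyP => i; rewrite ffunE.
case: (boolP (i \in W :\: _)) => //; rewrite inE negb_and negbK => h.
rewrite !inE /base; case: (split_ordP i) h => [a ->|b ->] h.
  by rewrite (fintype.subsetP rW) ?mem_roots // phix eqxx.
have nr : rshift g b \notin Defs.roots g k.
  by apply/imsetP => -[c _ /eqP]; rewrite eq_rlshift.
by case/orP: h => [h|/negPf ->//]; rewrite h in nr.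
Qed.

Lemma card_is_copy_le V E : Defs.roots g k \subset V ->
  (forall e, e \in E -> e \subset V) ->
  (#|is_copy V E x| <= n ^ #|V :\: Defs.roots g k|)%N.
Proof.
move=> rV EV; apply: leq_trans (card_restr_range V).
apply: leq_trans (leq_image_card (@copy_of g k n V E) _).
apply/subset_leq_card/fintype.subsetP => C /is_copyP[phi h ->].
have [_ phix] := is_extP _ _ _ h.
apply/imageP; exists (restr V phi); first exact: restr_in_range.
rewrite /copy_of; congr (_, _).
  by apply: eq_in_imset => i iV; rewrite ffunE iV.
apply: eq_in_imset => e /new_edges_sub eE; apply: eq_in_imset => i ie.
by rewrite ffunE (fintype.subsetP (EV _ eE)).
Qed.

Lemma ffact_le_card_ext :
  ((n - g) ^_ k <= #|[pred phi | is_ext g k n [set: 'I_(g + k)] x phi]|)%N.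
Proof.
pose Rg : pred 'I_n := [pred v | v \notin codom x].
have cR : #|Rg| = (n - g)%N.
  rewrite -[n in RHS]card_ord -(cardC (mem (codom x))) card_codom // card_ord addKn.
  by apply: eq_card => v; rewrite !inE.
rewrite -{1}[k]card_ord -cR -card_inj_ffuns_on.
pose ext (f : {ffun 'I_k -> 'I_n}) : {ffun 'I_(g + k) -> 'I_n} :=
  [ffun i => match split i with inl a => x a | inr b => f b end].
have extl f a : ext f (lshift k a) = x a by rewrite ffunE -[lshift k a]/(unsplit (inl a)) unsplitK.
have extr f b : ext f (rshift g b) = f b by rewrite ffunE -[rshift g b]/(unsplit (inr b)) unsplitK.
have ext_inj : injective ext.
  by move=> f f' ff; apply/ffunP => b; rewrite -!extr ff.
rewrite -(card_image ext_inj); apply/subset_leq_card/fintype.subsetP => phi.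
case/imageP=> f; rewrite inE => /andP[/ffun_onP fR /injectiveP fi] ->.
rewrite inE; apply/is_extP; split=> // u v _ _.
case: (split_ordP u) => [a ->|a ->]; case: (split_ordP v) => [b ->|b ->];
  rewrite ?extl ?extr.
- by move/x_inj ->.
- by move=> h; have := fR b; rewrite inE -h codom_f.
- by move=> h; have := fR a; rewrite inE h codom_f.
- by move/fi ->.
Qed.

(** Double counting of the injective placements of all g + k vertices, each of which induces a copy
    of J. Over a given copy, a vertex of V has at most g + k possible images and any other at most
    n; that power of n cancels in the end. *)
Lemma card_is_copy_ge V E : (2 * (g + k) <= n)%N -> Defs.roots g k \subset V ->
  (n ^ #|V :\: Defs.roots g k| <= copy_const g k * #|is_copy V E x|)%N.
Proof.
move=> le_n rV.
have kE : k = (#|V :\: Defs.roots g k| + #|~: V|)%N.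
  have := cardsC V; rewrite card_ord -(cardsID (Defs.roots g k) V).
  by rewrite (finset.setIidPr rV) card_roots; lia.
have fib : (#|[pred phi | is_ext g k n [set: 'I_(g + k)] x phi]|
    <= #|is_copy V E x| * ((g + k) ^ (g + k) * n ^ #|~: V|))%N.
  apply: (leq_card_fiber (f := copy_of g k n V E)) => [phi /is_extP[inj phix]|C _].
    apply/is_copyP; exists phi => //; apply/is_extP; split=> //.
    by move=> u v _ _; apply: inj; rewrite inE.
  have [gk0|gk0] := posnP (g + k).
    apply: leq_trans (max_card _) _.
    have -> : #|{ffun 'I_(g + k) -> 'I_n}| = 1%N by rewrite card_ffun !card_ord gk0.
    have gg : (0 < (g + k) ^ (g + k))%N by rewrite expn_gt0 gk0.
    by rewrite muln_gt0 gg expn_gt0 n_gt0.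
  have [->|[phi0 /andP[_ /eqP CE]]] : 
      #|[pred phi | is_ext g k n [set: 'I_(g + k)] x phi & copy_of g k n V E phi == C]| = 0%N
      \/ exists phi, is_ext g k n [set: 'I_(g + k)] x phi && (copy_of g k n V E phi == C).
    case: (pickP [pred phi | is_ext g k n [set: 'I_(g + k)] x phi & copy_of g k n V E phi == C]) => [phi h|h].
      by right; exists phi.
    by left; rewrite (eq_card h) card0.
    by [].
  have C1 : (#|C.1| <= g + k)%N.
    rewrite -CE; apply: leq_trans (leq_imset_card _ _) _.
    by rewrite -[leqRHS]card_ord max_card.
  apply: leq_trans (card_family_leq (F := fun i => if i \in ~: V then predT else mem C.1) gk0 _).
    apply/subset_leq_card/fintype.subsetP => phi; rewrite inE => /andP[_ /eqP <-].
    apply/familyP => i; case: ifP => //; rewrite inE => /negbFE iV.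
    by rewrite /= imset_f.
  by move=> i /negPf ->.
have := leq_trans (expn_le_ffact le_n) (leq_mul (leqnn (2 ^ k)) (leq_trans ffact_le_card_ext fib)).
rewrite {1}kE expnD !mulnA leq_pmul2r ?expn_gt0 ?n_gt0 //.
by rewrite /copy_const mulnAC.
Qed.

End Counting.

Lemma card_setC_roots (g k : nat) (V : {set 'I_(g + k)}) : Defs.roots g k \subset V ->
  (#|~: V| + #|V :\: Defs.roots g k| = k)%N.
Proof.
move=> rV; have := cardsC V; rewrite card_ord -(cardsID (Defs.roots g k) V).
by rewrite (finset.setIidPr rV) card_roots; lia.
Qed.

(** * Subgraphs of H: copies meeting a set of edges, and the variance *)

Section Subextensions.
Variables (R : realType) (g k n : nat) (EH : {set {set 'I_(g + k)}}).
Hypothesis hEH : forall e, e \in EH -> #|e| = 2%N.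
Hypothesis hGH : (#|root_edges g k EH| < #|EH|)%N.
Variables (p : R) (x : {ffun 'I_g -> 'I_n}).
Hypothesis p0 : 0 < p.
Hypothesis p1 : p <= 1.
Hypothesis x_inj : injective x.
Hypothesis n_gt0 : (0 < n)%N.
Hypothesis le_n : (2 * (g + k) <= n)%N.
Implicit Types (phi : {ffun 'I_(g + k) -> 'I_n}) (F : {set edge n}).
Implicit Types (V : {set 'I_(g + k)}) (E U : {set {set 'I_(g + k)}}).
Local Notation roots := (Defs.roots g k).
Local Notation muH := (mu R g k n p [set: 'I_(g + k)] EH).
Local Notation PhiH := (Phi R g k n p EH).
Local Notation copyH := (is_copy [set: 'I_(g + k)] EH x).

(** Between G and H the edges inside the roots are always those of G, so e_J > e_G means that J has
    a new edge. *)
Lemma ext_sub_new_edges J : ext_sub g k EH J ->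
  root_edges g k J.2 = root_edges g k EH /\ (0 < #|new_edges J.2|)%N.
Proof.
case/and5P=> _ reJ JE _ lt.
have re : root_edges g k J.2 = root_edges g k EH.
  apply/eqP; rewrite finset.eqEsubset; apply/andP; split; apply/fintype.subsetP => e.
    by rewrite !inE => /andP[/(fintype.subsetP JE) -> ->].
  by move=> h; have := fintype.subsetP reJ _ h; move: h; rewrite !inE => /andP[_ ->] ->.
by split=> //; rewrite /new_edges re cardsD (finset.setIidPr reJ) subn_gt0.
Qed.

Lemma ext_sub_mu J : ext_sub g k EH J ->
  mu R g k n p J.1 J.2 = #|is_copy J.1 J.2 x|%:R * p ^+ #|new_edges J.2|.
Proof.
case/and5P=> rJ _ JE EJ _; apply: mu_copies => //.
  by move=> e /(fintype.subsetP JE)/hEH.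
by move=> e eJ; move/'forall_implyP: EJ => /(_ _ eJ).
Qed.

Lemma ext_sub_H : ext_sub g k EH ([set: 'I_(g + k)], EH).
Proof.
apply/and5P; split=> //=.
- by apply/fintype.subsetP => e; rewrite inE => /andP[].
- by apply/'forall_implyP => e _; apply: subsetT.
Qed.

Lemma Phi_le_mu J : ext_sub g k EH J -> PhiH <= mu R g k n p J.1 J.2.
Proof. by move=> hJ; apply: bigmin_le_cond. Qed.

(** The initial value of the minimum, mu of H, is itself in the range. *)
Lemma Phi_attained : exists2 J, ext_sub g k EH J & PhiH = mu R g k n p J.1 J.2.
Proof.
rewrite /Phi; apply: (big_ind (fun m => exists2 J, ext_sub g k EH J & m = mu R g k n p J.1 J.2)).
- by exists ([set: 'I_(g + k)], EH) => //; apply: ext_sub_H.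
- move=> a b [Ja hJa ->] [Jb hJb ->].
  by case: leP => _; [exists Ja|exists Jb].
- by move=> J hJ; exists J.
Qed.

Lemma mu_H : muH = mean p copyH #|new_edges EH|.
Proof. by rewrite (ext_sub_mu ext_sub_H) /mean sumr_const mulr_natl. Qed.

Lemma mu_ge : n%:R ^+ k * p ^+ #|new_edges EH| <= (copy_const g k)%:R * muH.
Proof.
rewrite (ext_sub_mu ext_sub_H) /= mulrA ler_wpM2r ?exprn_ge0 ?(ltW p0) //.
rewrite -natrX -natrM ler_nat.
have := card_is_copy_ge x_inj n_gt0 EH le_n (finset.subsetT roots).
by have := card_setC_roots (finset.subsetT roots); rewrite finset.setCT cards0 add0n => ->.
Qed.

(* The edges of the subgraph J of H that [phi] places in [F]. *)
Definition hit phi F : {set {set 'I_(g + k)}} :=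
  [set e in new_edges EH | img (g + k) n phi e \in edges_of n F].

Lemma card_edge_setD phi F : is_ext g k n [set: 'I_(g + k)] x phi ->
  (#|edge_set (copy_of g k n [set: 'I_(g + k)] EH phi) :\: F| + #|hit phi F| = #|new_edges EH|)%N.
Proof.
move=> h; set C := copy_of _ _ _ _ _ _.
have hC : is_copy [set: 'I_(g + k)] EH x C by apply/is_copyP; exists phi.
rewrite -(card_edge_set_copy hEH _ hC); last by move=> e _; apply: finset.subsetT.
rewrite -[in RHS](cardsID F) addnC; congr (_ + _)%N.
rewrite -(card_imset (edge_set C :&: F) val_inj) -(card_in_imset (f := img (g + k) n phi) (D := hit phi F)).
  apply: eq_card => f; apply/imsetP/imsetP => [[e]|[t]].
    rewrite inE => /andP[eN /imsetP[t tF te]] ->; exists t => //.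
    by rewrite inE tF andbT inE -te; apply/imsetP; exists e.
  rewrite inE => /andP[]; rewrite inE => /imsetP[e eN te] tF ->; exists e => //.
  by rewrite inE eN -te; apply: imset_f.
move=> e f; rewrite !inE => /andP[/andP[_ eE] _] /andP[/andP[_ fE] _].
by apply: (img_inj (E := EH) (fun e' _ => finset.subsetT e') h).
Qed.

(** Roots are fixed, a vertex on an edge of U must land on one of the at most 2|F| endpoints of F,
    and the others are free. The maximum with 1 allows for the single choice at a root when F is
    empty. *)
Lemma card_hit_le F U : U \subset new_edges EH ->
  (#|[pred phi | is_ext g k n [set: 'I_(g + k)] x phi & hit phi F == U]|
   <= (maxn 1 (2 * #|F|)) ^ (g + k) * n ^ #|~: (roots :|: cover U)|)%N.
Proof.
move=> UN; pose CF := cover (edges_of n F).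
have cCF : (#|CF| <= 2 * #|F|)%N.
  apply: leq_trans (leq_card_cover _) _.
  rewrite (eq_bigr (fun=> 2%N)); last by move=> f /imsetP[t _ ->]; apply/eqP/(valP t).
  by rewrite sum_nat_const mulnC leq_mul2l leq_imset_card.
pose FF i : pred 'I_n := fun v =>
  if i \in roots then v == base x n_gt0 i else (i \in cover U) ==> (v \in CF).
have FF_le i : i \notin ~: (roots :|: cover U) -> (#|FF i| <= maxn 1 (2 * #|F|))%N.
  rewrite !inE negbK /FF; case: (i \in roots) => [_|/= iU].
    by rewrite (eq_card1 (x := base x n_gt0 i)) ?leq_max.
  rewrite iU; apply: (@leq_trans #|CF|); last by rewrite (leq_trans cCF) // leq_maxr.
  by apply/subset_leq_card/fintype.subsetP => v.
apply: leq_trans (card_family_leq _ FF_le); last by rewrite leq_max.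
apply/subset_leq_card/fintype.subsetP => phi; rewrite inE => /andP[/is_extP[_ phix] /eqP hU].
apply/familyP => i; rewrite unfold_in /FF; case: ifP => [/imsetP[a _ ->]|_].
  by rewrite phix /base -[lshift k a]/(unsplit (inl a)) unsplitK eqxx.
apply/implyP => /bigcupP[e eU ie]; move: eU; rewrite -hU inE => /andP[_ eF].
by apply/bigcupP; exists (img (g + k) n phi e) => //; apply: imset_f.
Qed.

(** No edge of U lies inside the roots, so U is disjoint from E(G), and a nonempty U makes this J
    eligible in the minimum defining [Phi]. *)
Lemma ext_sub_hit U : U \subset new_edges EH -> (0 < #|U|)%N ->
  ext_sub g k EH (roots :|: cover U, root_edges g k EH :|: U)
   /\ new_edges (root_edges g k EH :|: U) = U.
Proof.
move=> UN U0.
have dis e : e \in U -> e \in EH /\ ~~ (e \subset roots).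
  by move/(fintype.subsetP UN); rewrite !inE => /andP[h eE]; rewrite eE in h.
have h : ext_sub g k EH (roots :|: cover U, root_edges g k EH :|: U).
  apply/and5P; split=> /=.
  - exact: finset.subsetUl.
  - exact: finset.subsetUl.
  - apply/fintype.subsetP => e; rewrite !inE => /orP[/andP[]//|]; by case/dis.
  - apply/'forall_implyP => e; rewrite !inE => /orP[/andP[_ er]|eU].
      exact: (subset_trans er (finset.subsetUl _ _)).
    by apply: subset_trans (finset.subsetUr _ _); apply: bigcup_sup.
  - have dU : [disjoint U & root_edges g k EH].
      rewrite disjoints_subset; apply/fintype.subsetP => e /dis[eE er].
      by rewrite !inE eE.
    by rewrite finset.setUC cardsUD (finset.setDidPl dU) -[ltnLHS]add0n ltn_add2r.
split=> //; have [re _] := ext_sub_new_edges h; rewrite /new_edges re /=.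
apply/setP => e; rewrite !inE; case: (boolP (e \in U)) => [/dis[eE /negPf ->]|_].
  by rewrite andbF orbT.
by rewrite orbF andNb.
Qed.

(** The factors count the possible hit patterns U, bound the ways to place the vertices covered by U
    on F, and compare n^k p^(e_H - e_G) with mu_H. *)
Definition meet_const (B : nat) : R :=
  #|{set {set 'I_(g + k)}}|%:R * ((maxn 1 (2 * B)) ^ (g + k))%:R * (copy_const g k)%:R.

(** Passing from copies to embeddings only increases the sum. The O(n^(v_H - v_J)) embeddings with
    hit pattern U have weight p^(e_H - e_J) each; times mu_J <= n^(v_J - v_G) p^(e_J - e_G) this is
    O(mu_H), and mu_J >= Phi. *)
Lemma sum_copy_meet_le (B : nat) F : 0 < PhiH -> (#|F| <= B)%N ->
  \sum_(C | copyH C && ~~ [disjoint edge_set C & F]) p ^+ #|edge_set C :\: F|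
    <= meet_const B * muH / PhiH.
Proof.
move=> Phi0 FB; pose cp := copy_of g k n [set: 'I_(g + k)] EH.
pose Q phi := is_ext g k n [set: 'I_(g + k)] x phi && (0 < #|hit phi F|)%N.
apply: (@le_trans _ _ (\sum_(phi | Q phi) p ^+ #|edge_set (cp phi) :\: F|)).
  apply: (@ler_sum_image R _ _ cp Q _ (fun C => p ^+ #|edge_set C :\: F|)) => [C|C /andP[hC nd]].
    by rewrite exprn_ge0 // ltW.
  have [phi h CE] := is_copyP _ _ _ _ hC; exists phi => //.
  rewrite /Q h /=; have := card_edge_setD F h; rewrite -CE -(card_edge_set_copy hEH _ hC); last first.
    by move=> e _; apply: finset.subsetT.
  rewrite -(cardsID F (edge_set C)) addnC => /addIn ->; rewrite card_gt0.
  by rewrite finset.setI_eq0.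
rewrite (partition_big (fun phi => hit phi F) xpredT) //= /meet_const.
pose c : R := ((maxn 1 (2 * B)) ^ (g + k))%:R * ((copy_const g k)%:R * (muH / PhiH)).
rewrite (_ : _ / PhiH = \sum_(U : {set {set 'I_(g + k)}}) c); last first.
  by rewrite sumr_const -[RHS]mulr_natl /c !mulrA.
apply: ler_sum => U _ /=.
have c_ge0 : 0 <= c.
  rewrite !mulr_ge0 ?invr_ge0 ?(ltW Phi0) //; apply/ltW; exact: lt_le_trans (Phi_le_mu ext_sub_H).
have [UN|UN] := boolP ((U \subset new_edges EH) && (0 < #|U|)%N); last first.
  rewrite big1 // => phi /andP[/andP[_ h0] /eqP hU]; case/negP: UN.
  rewrite -hU h0 andbT; apply/fintype.subsetP => e; by rewrite inE => /andP[].
case/andP: UN => UN U0.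
have [hJ nJ] := ext_sub_hit UN U0.
rewrite (eq_bigr (fun=> p ^+ (#|new_edges EH| - #|U|))); last first.
  by move=> phi /andP[/andP[h _] /eqP hU]; rewrite -(card_edge_setD F h) hU addnK.
rewrite sumr_const -[leLHS]mulr_natl.
apply: (@le_trans _ _ (((maxn 1 (2 * B)) ^ (g + k))%:R * ((n ^ #|~: (roots :|: cover U)|)%:R * p ^+ (#|new_edges EH| - #|U|)))).
  rewrite mulrA ler_wpM2r ?exprn_ge0 ?(ltW p0) // -natrM ler_nat.
  apply: leq_trans (leq_trans (card_hit_le F UN) _).
    by apply/subset_leq_card/fintype.subsetP => phi; rewrite !inE => /andP[/andP[-> _] ->].
  have mono a b d : (a <= b -> a ^ d <= b ^ d)%N by case: d => // d; rewrite leq_exp2r.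
  by apply: leq_mul => //; apply: mono; rewrite geq_max !leq_max leq_mul2l FB !orbT.
rewrite ler_wpM2l // mulrA ler_pdivlMr //.
apply: le_trans mu_ge.
apply: le_trans (ler_wpM2l _ (Phi_le_mu hJ)) _; first by rewrite mulr_ge0 ?exprn_ge0 ?(ltW p0).
rewrite (ext_sub_mu hJ) nJ /=.
apply: (@le_trans _ _ ((n ^ #|~: (roots :|: cover U)|)%:R * p ^+ (#|new_edges EH| - #|U|) *
  ((n ^ #|(roots :|: cover U) :\: roots|)%:R * p ^+ #|U|))).
  rewrite ler_wpM2l ?mulr_ge0 ?exprn_ge0 ?(ltW p0) // ler_wpM2r ?exprn_ge0 ?(ltW p0) //.
  rewrite ler_nat; apply: card_is_copy_le => //; first exact: finset.subsetUl.
  case/and5P: hJ => _ _ _ /'forall_implyP hh _; exact: hh.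
rewrite mulrACA -natrM -expnD card_setC_roots ?finset.subsetUl // -exprD subnK ?natrX //.
exact: subset_leq_card.
Qed.

(* Fix J attaining Phi.  Two copies that agree on J share all its new edges, and by
   Cauchy-Schwarz over the placements of J at least N^2 / n^(v_J - v_G) pairs of copies
   agree on J. *)
Lemma var_ge : (1 - p) * muH ^+ 2 <= (copy_const g k)%:R * PhiH * var p copyH (@edge_set n) #|new_edges EH|.
Proof.
have [[V E] hJ ->] := Phi_attained.
have [re j0] := ext_sub_new_edges hJ; rewrite (ext_sub_mu hJ) /= in re j0 *.
have [rV _ JE EJ _] := and5P hJ; rewrite /= in rV JE EJ.
set j := #|new_edges E| in j0 *; set e := #|new_edges EH|.
pose N : R := #|copyH|%:R.
have cN : #|copyH|%:R = N by [].
have muN : muH = N * p ^+ e by rewrite (ext_sub_mu ext_sub_H).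
have a_e C : copyH C -> #|edge_set C| = e.
  by move=> hC; apply: (card_edge_set_copy hEH _ hC) => f _; apply: finset.subsetT.
have p01 : 0 <= p <= 1 by rewrite ltW.
pose ph (C : {set 'I_n} * {set {set 'I_n}}) : {ffun 'I_(g + k) -> 'I_n} :=
  odflt [ffun=> Ordinal n_gt0] [pick phi | is_ext g k n [set: 'I_(g + k)] x phi && (C == copy_of g k n [set: 'I_(g + k)] EH phi)].
have phP C : copyH C -> is_ext g k n [set: 'I_(g + k)] x (ph C) /\ C = copy_of g k n [set: 'I_(g + k)] EH (ph C).
  move=> /is_copyP[phi h CE]; rewrite /ph; case: pickP => [psi /andP[? /eqP]//|/(_ phi)].
  by rewrite h CE eqxx.
pose r C := restr n_gt0 V (ph C).
pose Y := restr_range x n_gt0 V.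
have rY C : copyH C -> Y (r C).
  by case/phP=> /is_extP[_ phix] _; apply: restr_in_range.
pose M : R := #|Y|%:R.
have M_le : M <= (copy_const g k)%:R * #|is_copy V E x|%:R.
  rewrite -natrM ler_nat; apply: leq_trans (card_restr_range _ _ _) _.
  exact: card_is_copy_ge.
pose c y : R := \sum_(C | copyH C && (r C == y)) 1.
have sum_c : \sum_(y | Y y) c y = N.
  by rewrite -(partition_big r Y) //= sumr_const.
(* Cauchy-Schwarz, by expanding the nonnegative sum of (M c_y - N)^2. *)
have cs : N ^+ 2 <= M * \sum_(y | Y y) c y ^+ 2.
  have [M0|M0] := posnP #|Y|.
    rewrite /M M0 mul0r -sum_c big1 ?expr0n // => y Yy.
    have yY : y \in Y by exact: Yy.
    by rewrite (card0_eq M0) in yY.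
  have Mp : 0 < M by rewrite ltr0n.
  have : 0 <= \sum_(y | Y y) (M * c y - N) ^+ 2 by apply: sumr_ge0 => y _; rewrite sqr_ge0.
  rewrite (eq_bigr (fun y => M ^+ 2 * c y ^+ 2 + ((- 2 * M * N) * c y + N ^+ 2))); last by move=> y _; ring.
  rewrite !big_split /= -!mulr_sumr sum_c sumr_const -mulr_natl -/M => le0.
  rewrite -(ler_pM2l Mp) -subr_ge0; apply: le_trans le0 _.
  by rewrite le_eqVlt; apply/orP; left; apply/eqP; ring.
(* The covariance is p^(2e - i) - p^(2e), i being the number of common edges. It is nonnegative, and
   if the placements of J agree then i >= j >= 1, so it is at least p^(2e - j) (1 - p). *)
have cov_ge C D : copyH C -> copyH D ->
    (1 - p) * p ^+ (2 * e - j) * (r C == r D)%:R <=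
    Ex R n p (fun S => xi p (@edge_set n) e C S * xi p (@edge_set n) e D S).
  move=> hC hD.
  have -> : Ex R n p (fun S => xi p (@edge_set n) e C S * xi p (@edge_set n) e D S) =
      p ^+ #|edge_set C :|: edge_set D| - p ^+ e * p ^+ e.
    rewrite (eq_Ex (h := fun S => ind R (edge_set C :|: edge_set D) S - p ^+ e * ind R (edge_set D) S
       - (p ^+ e * ind R (edge_set C) S - p ^+ e * p ^+ e))); last first.
      by move=> S; rewrite -indM /xi; move: (ind _ _ _) (ind _ _ _) (p ^+ e) => u v w; ring.
    by rewrite !ExB !ExZ Ex_cst !Ex_ind !a_e // subrr subr0.
  have UI := cardsUI (edge_set C) (edge_set D); rewrite !a_e // in UI.
  have [rCD|_] := eqVneq (r C) (r D); last first.
    rewrite mulr0 subr_ge0 -exprD ler_wiXn2l ?(ltW p0) // -UI leq_addr //.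
  have jI : (j <= #|edge_set C :&: edge_set D|)%N.
    have [hc Ce] := phP _ hC; have [hd De] := phP _ hD.
    have NE f : f \in new_edges E -> f \in new_edges EH.
      by rewrite /new_edges re !inE => /andP[-> /(fintype.subsetP JE)].
    rewrite /j -(card_imset (edge_set C :&: edge_set D) val_inj).
    rewrite -(card_in_imset (f := img (g + k) n (ph C)) (D := new_edges E)); last first.
      move=> f f' /NE/new_edges_sub fE /NE/new_edges_sub fE'.
      by apply: (img_inj (E := EH) (fun e' _ => finset.subsetT e') hc).
    apply/subset_leq_card/fintype.subsetP => f0 /imsetP[f fN ->].
    have fE := new_edges_sub (NE _ fN).
    have f2 : #|img (g + k) n (ph C) f| == 2%N.
      by apply/eqP; apply: (card_img hEH _ hc fE) => e' _; apply: finset.subsetT.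
    apply/imsetP; exists (Sub (img (g + k) n (ph C) f) f2) => //.
    have fV : f \subset V by move/'forall_implyP: EJ => /(_ f); apply; apply: new_edges_sub.
    have CD : img (g + k) n (ph C) f = img (g + k) n (ph D) f.
      apply: eq_in_imset => i /(fintype.subsetP fV) iV.
      by have := congr1 (fun z : {ffun 'I_(g + k) -> 'I_n} => z i) rCD; rewrite !ffunE iV.
    rewrite !inE /=; apply/andP; split.
      by rewrite (congr1 snd Ce); apply/imsetP; exists f; first exact: NE.
    by rewrite (congr1 snd De) CD; apply/imsetP; exists f; first exact: NE.
  set i := #|edge_set C :&: edge_set D| in UI jI.
  have i2e : (i <= 2 * e)%N by rewrite mul2n -addnn -UI leq_addl.
  have -> : #|edge_set C :|: edge_set D| = (2 * e - i)%N by rewrite mul2n -addnn -UI addnK.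
  rewrite mulr1 -exprD (_ : (e + e = (2 * e - i) + i)%N); last by rewrite subnK // mul2n addnn.
  rewrite [in leRHS]exprD -{1}[p ^+ (2 * e - i)]mulr1 -mulrBr mulrC.
  apply: ler_pM; rewrite ?exprn_ge0 ?subr_ge0 ?(ltW p0) //.
    by rewrite ler_wiXn2l ?(ltW p0) // leq_sub2l.
  rewrite lerD2l lerN2; case: (i) jI => [|i' _]; first by rewrite leqNgt j0.
  by rewrite exprS ler_piMr ?exprn_ile1 // ltW.
have var_ge0 : (1 - p) * p ^+ (2 * e - j) * \sum_(y | Y y) c y ^+ 2 <= var p copyH (@edge_set n) e.
  rewrite /var (eq_Ex (h := fun S => \sum_(C | copyH C) \sum_(D | copyH D)
      xi p (@edge_set n) e C S * xi p (@edge_set n) e D S)); last first.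
    by move=> S; rewrite expr2 mulr_suml; apply: eq_bigr => C _; rewrite mulr_sumr.
  rewrite Ex_sum.
  have -> : \sum_(y | Y y) c y ^+ 2 = \sum_(C | copyH C) \sum_(D | copyH D) (r C == r D)%:R.
    rewrite (partition_big r Y) //=; apply: eq_bigr => y _.
    rewrite expr2 {1}/c mulr_suml; apply: eq_bigr => C /andP[hC /eqP rC].
    rewrite mul1r /c big_mkcondr; apply: eq_bigr => D _; rewrite rC eq_sym.
    by case: (y == _).
  rewrite mulr_sumr; apply: ler_sum => C hC; rewrite Ex_sum mulr_sumr.
  by apply: ler_sum => D hD; apply: cov_ge.
have var0 : 0 <= var p copyH (@edge_set n) e by apply: Ex_ge0 => // S; rewrite sqr_ge0.
have je : (j <= e)%N.
  apply/subset_leq_card/fintype.subsetP => f; rewrite /new_edges re !inE => /andP[-> ].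
  exact: (fintype.subsetP JE).
rewrite muN.
apply: (@le_trans _ _ (M * (p ^+ j * var p copyH (@edge_set n) e))).
  apply: (@le_trans _ _ (M * (p ^+ j * ((1 - p) * p ^+ (2 * e - j) * \sum_(y | Y y) c y ^+ 2)))).
    have -> : (1 - p) * (N * p ^+ e) ^+ 2 = (1 - p) * (p ^+ j * p ^+ (2 * e - j)) * N ^+ 2.
      rewrite -exprD subnKC; last by rewrite (leq_trans je) // leq_pmull.
      by rewrite exprMn -exprM mulnC -mulrA [_ ^+ 2 * _]mulrC.
    have -> (s2 q : R) : M * (p ^+ j * (q * p ^+ (2 * e - j) * s2)) = q * (p ^+ j * p ^+ (2 * e - j)) * (M * s2).
      by move: (p ^+ j) (p ^+ (2 * e - j)) => u v; ring.
    by rewrite ler_wpM2l // !mulr_ge0 ?exprn_ge0 ?subr_ge0 ?(ltW p0).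
  by rewrite !ler_wpM2l ?exprn_ge0 ?ler0n ?(ltW p0).
rewrite !mulrA -mulrA -[leRHS]mulrA ler_wpM2r // mulr_ge0 ?exprn_ge0 ?(ltW p0) //.
Qed.

End Subextensions.

(** * The two tails *)

(** Here m, t, F stand for mu, the standard deviation and Phi, and [kappa * m / F] for K. With z = m
    / t one has b z^2 <= F, so the errors are O(1 / (d F)) and O(1 / (d sqrt F)). *)
Lemma stein_error_le (R : realType) (m F t kappa b d : R) : 0 < t -> 0 < m -> 0 < F -> 0 < d -> 0 < b ->
  0 <= kappa -> b * m ^+ 2 <= F * t ^+ 2 -> 128 * kappa ^+ 3 <= d ^+ 2 * b ^+ 2 * F ->
  (32 * kappa ^+ 2) ^+ 2 <= b ^+ 3 * d ^+ 4 * F ->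
  128 * m * (kappa * m / F) ^+ 3 / (d * t ^+ 4) <= d /\
  32 * m * (kappa * m / F) ^+ 2 / (d * t ^+ 3) <= d.
Proof.
move=> t0 m0 F0 d0 b0 k0 bm h1 h2.
pose z := m / t; have z0 : 0 < z by rewrite divr_gt0.
have bz : b * z ^+ 2 <= F by rewrite expr_div_n mulrA ler_pdivrMr ?exprn_gt0.
have bz0 : 0 <= b * z ^+ 2 by rewrite mulr_ge0 ?sqr_ge0 ?ltW.
split.
  have -> : 128 * m * (kappa * m / F) ^+ 3 / (d * t ^+ 4) = 128 * kappa ^+ 3 * z ^+ 4 / (d * F ^+ 3).
    by rewrite /z; field; rewrite !gt_eqF.
  rewrite ler_pdivrMr ?mulr_gt0 ?exprn_gt0 // -(ler_pM2l (_ : 0 < b ^+ 2)) ?exprn_gt0 //.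
  apply: (@le_trans _ _ (128 * kappa ^+ 3 * F ^+ 2)).
    rewrite [leLHS](_ : _ = 128 * kappa ^+ 3 * (b * z ^+ 2) ^+ 2); last by ring.
    by rewrite ler_wpM2l ?mulr_ge0 ?exprn_ge0 // lerXn2r ?nnegrE // ltW.
  rewrite [leRHS](_ : _ = d ^+ 2 * b ^+ 2 * F * F ^+ 2); last by ring.
  by rewrite ler_wpM2r ?exprn_ge0 // ltW.
have -> : 32 * m * (kappa * m / F) ^+ 2 / (d * t ^+ 3) = 32 * kappa ^+ 2 * z ^+ 3 / (d * F ^+ 2).
  by rewrite /z; field; rewrite !gt_eqF.
rewrite ler_pdivrMr ?mulr_gt0 ?exprn_gt0 //.
have lhs0 : 0 <= 32 * kappa ^+ 2 * z ^+ 3 by rewrite mulr_ge0 ?exprn_ge0 ?(ltW z0) // mulr_ge0 ?exprn_ge0.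
have rhs0 : 0 <= d * (d * F ^+ 2) by rewrite ltW // !mulr_gt0 ?exprn_gt0.
(* Squaring turns the odd power of z into a power of z^2. *)
rewrite -(@ler_pXn2r _ 2) ?nnegrE //.
rewrite -(ler_pM2l (_ : 0 < b ^+ 3)) ?exprn_gt0 //.
apply: (@le_trans _ _ ((32 * kappa ^+ 2) ^+ 2 * F ^+ 3)).
  rewrite [leLHS](_ : _ = (32 * kappa ^+ 2) ^+ 2 * (b * z ^+ 2) ^+ 3); last by ring.
  by rewrite ler_wpM2l ?exprn_ge0 ?mulr_ge0 ?sqr_ge0 // lerXn2r ?nnegrE // ltW.
rewrite [leRHS](_ : _ = b ^+ 3 * d ^+ 4 * F * F ^+ 3); last by ring.
by rewrite ler_wpM2r ?exprn_ge0 // ltW.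
Qed.

Lemma copy_const_gt0 (g k : nat) : (0 < copy_const g k)%N.
Proof. by rewrite /copy_const muln_gt0 !expn_gt0 /=; case: (posnP (g + k)). Qed.

Section Tails.
Variables (R : realType) (g k n : nat) (EH : {set {set 'I_(g + k)}}).
Hypothesis hEH : forall e, e \in EH -> #|e| = 2%N.
Hypothesis hGH : (#|root_edges g k EH| < #|EH|)%N.
Variables (p eps : R).
Hypothesis p0 : 0 < p.
Hypothesis p1 : p <= 1.
Hypothesis n_gt0 : (0 < n)%N.
Hypothesis le_n : (2 * (g + k) <= n)%N.
Local Notation muH := (mu R g k n p [set: 'I_(g + k)] EH).
Local Notation PhiH := (Phi R g k n p EH).
Local Notation copyH x := (is_copy [set: 'I_(g + k)] EH x).
Local Notation eH := #|new_edges EH|.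
Local Notation devH x := (dev p (copyH x) (@edge_set n) eH).
Hypothesis Phi0 : 0 < PhiH.
Implicit Types (x : {ffun 'I_g -> 'I_n}).

Let p01 : 0 <= p <= 1. Proof. by rewrite ltW. Qed.

Lemma mu_gt0 : 0 < muH.
Proof. exact: lt_le_trans (Phi_le_mu _ _ (ext_sub_H hGH)). Qed.

Lemma card_edge_setH x C : copyH x C -> #|edge_set C| = eH.
Proof. by move=> hC; apply: (card_edge_set_copy hEH _ hC) => f _; apply: finset.subsetT. Qed.

Lemma devHE x S : injective x ->
  devH x S = (Xext g k n [set: 'I_(g + k)] EH x S)%:R - muH.
Proof.
move=> xi; rewrite (Xext_sum hEH) => [|e _]; last exact: finset.subsetT.
by rewrite (mu_H hEH hGH p xi) /mean -sumrB.
Qed.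

(** This is [moment_le] with y = 1 / Phi, which makes y * [mean] + K a constant multiple of mu /
    Phi. *)
Lemma Ex_devH_le x (m : nat) : injective x -> 1 <= PhiH ->
  Ex R n p (fun S => devH x S ^+ (2 * m)) <=
  2 * 4 ^+ m * (1 + meet_const R g k (2 * m * eH)) ^+ (2 * m) * (muH ^+ (2 * m) / PhiH ^+ m).
Proof.
move=> xi Phi1; set B := (2 * m * eH)%N.
have y01 : 0 < PhiH^-1 <= 1 by rewrite invr_gt0 Phi0 invf_le1.
have := moment_le p01 (@card_edge_setH x)
  (fun F leF => sum_copy_meet_le hEH hGH p0 xi n_gt0 le_n Phi0 leF) y01 (leqnn B).
rewrite -(mu_H hEH hGH p xi) => le1; apply: le_trans le1 _.
rewrite (_ : PhiH^-1 * muH + _ = (1 + meet_const R g k B) * (muH / PhiH)); last first.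
  by rewrite [PhiH^-1 * _]mulrC mulrDl mul1r mulrA.
rewrite le_eqVlt; apply/orP; left; apply/eqP.
rewrite exprVn invrK !exprMn exprVn mulnC [PhiH ^+ (m * 2)]exprM.
have : PhiH ^+ m != 0 by rewrite expf_neq0 // gt_eqF.
move: (PhiH ^+ m) (muH ^+ _) ((1 + _) ^+ _) (4 ^+ m) => a b c d a0.
by field.
Qed.

(** If S is not good, some root tuple has |D| >= eps mu, so (D / (eps mu))^(2m) >= 1 there. Summing
    this power over all tuples performs Markov's inequality and the union bound together. *)
Lemma Pr_good_ge (m : nat) : 1 <= PhiH -> 0 < eps ->
  1 - Pr R n p (good R g k n p eps EH) <=
  n%:R ^+ g * (2 * 4 ^+ m * (1 + meet_const R g k (2 * m * eH)) ^+ (2 * m) / (eps ^+ 2 * PhiH) ^+ m).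
Proof.
move=> Phi1 eps0; set C := 2 * _ * _.
have C0 : 0 <= C.
  by rewrite !mulr_ge0 // exprn_even_ge0 // oddM.
have mu0 := mu_gt0; have em0 : 0 < eps * muH by rewrite mulr_gt0.
rewrite PrE -[X in X - _](Ex_cst n p 1) -ExB.
apply: (@le_trans _ _ (Ex R n p (fun S => \sum_(x : {ffun 'I_g -> 'I_n} | injectiveb x)
   (eps * muH) ^- (2 * m) * devH x S ^+ (2 * m)))).
  apply: le_Ex => // S.
  have ge0 x : 0 <= (eps * muH) ^- (2 * m) * devH x S ^+ (2 * m).
    by rewrite mulr_ge0 ?exprn_even_ge0 ?oddM // invr_ge0 exprn_ge0 // ltW.
  have [_|] := boolP (good R g k n p eps EH S); first by rewrite subrr sumr_ge0.
  rewrite negb_forall subr0 => /existsP[x]; rewrite negb_imply -leNgt => /andP[xi le1].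
  rewrite (bigD1 x) //= ler_wpDr ?sumr_ge0 //.
  rewrite mulrC ler_pdivlMr ?exprn_gt0 // mul1r.
  rewrite -[leRHS]ger0_norm ?exprn_even_ge0 ?oddM // normrX.
  by rewrite lerXn2r ?nnegrE ?(ltW em0) // devHE //; apply/injectiveP.
rewrite Ex_sum.
apply: (@le_trans _ _ (\sum_(x : {ffun 'I_g -> 'I_n}) C / (eps ^+ 2 * PhiH) ^+ m)).
  rewrite big_mkcond; apply: ler_sum => x _; case: ifP => [/injectiveP xi|_]; last first.
    by rewrite divr_ge0 // exprn_ge0 // mulr_ge0 ?sqr_ge0 // ltW.
  rewrite ExZ mulrC ler_pdivrMr ?exprn_gt0 //.
  apply: le_trans (Ex_devH_le m xi Phi1) _.
  rewrite -/C le_eqVlt; apply/orP; left; apply/eqP.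
  rewrite [(_ * PhiH) ^+ m]exprMn [(eps * _) ^+ _]exprMn -[eps ^+ 2 ^+ m]exprM.
  have : eps ^+ (2 * m) != 0 by rewrite expf_neq0 // gt_eqF.
  have : PhiH ^+ m != 0 by rewrite expf_neq0 // gt_eqF.
  move: (PhiH ^+ m) (muH ^+ _) (eps ^+ _) => a b c a0 c0.
  by field; rewrite a0.
by rewrite sumr_const card_ffun !card_ord -[leLHS]mulr_natl natrX.
Qed.

(** By [var_ge], b mu^2 <= Phi var, so the condition on eps gives eps mu <= d sqrt(var). The last
    two conditions make each error term of [anticoncentration] at most d, for a total of 6 d + d +
    d. *)
Lemma Pr_good_le (c d : R) : (g <= n)%N -> 0 < c -> c <= 1 - p -> 0 < d -> 0 < eps ->
  let b := c / (copy_const g k)%:R in let kappa := meet_const R g k (4 * eH) in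
  eps ^+ 2 * PhiH <= d ^+ 2 * b -> 
  128 * kappa ^+ 3 <= d ^+ 2 * b ^+ 2 * PhiH ->
  (32 * kappa ^+ 2) ^+ 2 <= b ^+ 3 * d ^+ 4 * PhiH ->
  Pr R n p (good R g k n p eps EH) <= 8 * d.
Proof.
move=> gn c0 cp d0 eps0 b kappa h0 h1 h2.
pose x : {ffun 'I_g -> 'I_n} := [ffun i => widen_ord gn i].
have xi : injective x by move=> i j; rewrite !ffunE => /(congr1 val)/= /val_inj.
have L0 : 0 < (copy_const g k)%:R :> R by rewrite ltr0n copy_const_gt0.
have b0 : 0 < b by rewrite divr_gt0.
have mu0 := mu_gt0.
set v := var p (copyH x) (@edge_set n) eH.
have kappa0 : 0 <= kappa by rewrite !mulr_ge0.
have bv : b * muH ^+ 2 <= PhiH * v.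
  rewrite /b mulrAC ler_pdivrMr // mulrC [PhiH * _ * _]mulrC mulrA.
  apply: le_trans (var_ge hEH hGH p0 p1 xi n_gt0 le_n).
  by rewrite mulrC ler_wpM2r ?sqr_ge0.
have v0 : 0 < v.
  by rewrite -(pmulr_rgt0 _ Phi0); apply: lt_le_trans bv; rewrite mulr_gt0 ?exprn_gt0.
have t0 : 0 < Num.sqrt v by rewrite sqrtr_gt0.
have vt : v = Num.sqrt v ^+ 2 by rewrite sqr_sqrtr // ltW.
have sub : eps * muH <= d * Num.sqrt v.
  rewrite -(@ler_pXn2r _ 2) ?nnegrE ?mulr_ge0 ?(ltW eps0) ?(ltW mu0) ?(ltW d0) ?(ltW t0) // !exprMn -vt.
  rewrite -(ler_pM2l Phi0).
  apply: (@le_trans _ _ (d ^+ 2 * (b * muH ^+ 2))).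
    rewrite mulrCA [leLHS]mulrA [leRHS]mulrA.
    by apply: ler_wpM2r; rewrite ?sqr_ge0.
  by rewrite [leRHS]mulrCA ler_wpM2l ?sqr_ge0.
have := anticoncentration p01 (@card_edge_setH x)
  (fun F leF => sum_copy_meet_le hEH hGH p0 xi n_gt0 le_n Phi0 leF) (leqnn _) v0 d0.
rewrite -/v -(mu_H hEH hGH p xi) -/kappa => le1.
rewrite vt in bv.
have [e1 e2] := stein_error_le t0 mu0 Phi0 d0 b0 kappa0 bv h1 h2.
apply: (@le_trans _ _ (6 * d + d + d)); last by rewrite le_eqVlt; apply/orP; left; apply/eqP; ring.
apply: le_trans (le_trans le1 _); last by rewrite !lerD.
rewrite !PrE; apply: le_Ex => // S; rewrite ler_nat.
have xb : injectiveb x by exact/injectiveP.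
case: (boolP (good _ _ _ _ _ _ _ _)) => // /forallP/(_ x)/implyP/(_ xb) le2.
by rewrite devHE // (le_trans (ltW le2)).
Qed.

End Tails.

(** As H has a new edge, mu_H = 0 at p = 0, and Phi <= mu_H. *)
Lemma Phi_gt0_p_gt0 (R : realType) (g k n : nat) (p : R) (EH : {set {set 'I_(g + k)}}) :
  (forall e, e \in EH -> #|e| = 2%N) -> (#|root_edges g k EH| < #|EH|)%N ->
  (g <= n)%N -> 0 <= p -> 0 < Phi R g k n p EH -> 0 < p.
Proof.
move=> hEH hGH gn; rewrite le_eqVlt => /predU1P[<-|//] Phi0.
pose x : {ffun 'I_g -> 'I_n} := [ffun i => widen_ord gn i].
have xi : injective x by move=> i j; rewrite !ffunE => /(congr1 val)/= /val_inj.
have := lt_le_trans Phi0 (Phi_le_mu _ _ (ext_sub_H hGH)).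
rewrite (ext_sub_mu hEH _ xi (ext_sub_H hGH)) /=.
have [_] := ext_sub_new_edges (ext_sub_H hGH); rewrite lt0n => /negPf e0.
by rewrite expr0n e0 mulr0 ltxx.
Qed.

(** * Choice of the parameters and passage to the limit *)

Import numFieldNormedType.Exports.
Local Open Scope classical_set_scope.
Unset Implicit Arguments.

Theorem theorem4 (R : realType) (g k : nat) (EH : {set {set 'I_(g + k)}})
  (hEH : forall e, e \in EH -> #|e| = 2%N)
  (hGH : (#|root_edges g k EH| < #|EH|)%N)
  (p eps : nat -> R)
  (hp : forall n, 0 <= p n <= 1)
  (heps : forall n, 0 < eps n <= 1)
  (hp1 : exists2 c : R, 0 < c & \forall n \near \oo, c <= 1 - p n)
  (hPhi : (fun n => Phi R g k n (p n) EH) @ \oo --> +oo) :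
  ((fun n => eps n ^+ 2 * Phi R g k n (p n) EH) @ \oo --> (0 : R) ->
     (fun n => Pr R n (p n) (good R g k n (p n) (eps n) EH)) @ \oo --> (0 : R))
  /\
  ((exists2 c : R, 0 < c &
      \forall n \near \oo, (n%:R) `^ c <= eps n ^+ 2 * Phi R g k n (p n) EH) ->
     (fun n => Pr R n (p n) (good R g k n (p n) (eps n) EH)) @ \oo --> (1 : R)).
Proof.
have p_le1 n : p n <= 1 by case/andP: (hp n).
have p_ge0 n : 0 <= p n by case/andP: (hp n).
have eps_gt0 n : 0 < eps n by case/andP: (heps n).
have Pr_le1 n : Pr R n (p n) (good R g k n (p n) (eps n) EH) <= 1.
  rewrite PrE -[leRHS](Ex_cst n (p n)); apply: le_Ex => // S.
  by rewrite lern1 leq_b1.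
have Pr_ge0 n : 0 <= Pr R n (p n) (good R g k n (p n) (eps n) EH).
  by rewrite PrE; apply: Ex_ge0 => // S; rewrite ler0n.
move/cvgryPge: hPhi => hPhi; split.
  case: hp1 => c c0 hc /cvgrPdist_le h0; apply/cvgrPdist_le => eta eta0.
  (* The bound of [Pr_good_le] is 8 d. *)
  pose d := eta / 8; have d0 : 0 < d by rewrite divr_gt0.
  pose b : R := c / (copy_const g k)%:R.
  pose kappa := meet_const R g k (4 * #|new_edges EH|).
  have b0 : 0 < b.
    by rewrite divr_gt0 // ltr0n copy_const_gt0.
  have db0 : 0 < d ^+ 2 * b by rewrite mulr_gt0 ?exprn_gt0.
  have a1 : 0 < d ^+ 2 * b ^+ 2 by rewrite mulr_gt0 ?exprn_gt0.
  have a2 : 0 < b ^+ 3 * d ^+ 4 by rewrite mulr_gt0 ?exprn_gt0.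
  have {}h0 := h0 _ db0.
  near=> n.
  have Phi0 : 0 < Phi R g k n (p n) EH.
    by apply: (lt_le_trans ltr01); near: n; apply: hPhi.
  have le_n : (2 * (g + k) <= n)%N by near: n; apply: nbhs_infty_ge.
  have n_gt0 : (0 < n)%N by near: n; apply: nbhs_infty_gt.
  have gn : (g <= n)%N by lia.
  have p0 := Phi_gt0_p_gt0 hEH hGH gn (p_ge0 n) Phi0.
  rewrite sub0r normrN ger0_norm //.
  rewrite (_ : eta = 8 * d); last by rewrite /d; field.
  apply: (@Pr_good_le _ _ _ _ _ hEH hGH _ _ p0 (p_le1 n) n_gt0 le_n Phi0 c) => //.
  - by near: n.
  - have : `|0 - eps n ^+ 2 * Phi R g k n (p n) EH| <= d ^+ 2 * b by near: n.
    by apply: le_trans; rewrite sub0r normrN ler_norm.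
  - by rewrite [leRHS]mulrC -ler_pdivrMr //; near: n; apply: hPhi.
  - by rewrite [leRHS]mulrC -ler_pdivrMr //; near: n; apply: hPhi.
case=> c c0 hc; apply/cvgrPdist_le => eta eta0.
(* With c m >= g + 1, (eps^2 Phi)^m >= n^(g + 1) beats the n^g of the union bound by a factor n. *)
pose m := Num.Def.archi_bound ((g.+1)%:R / c).
have cm : (g.+1)%:R <= c * m%:R.
  by rewrite mulrC -ler_pdivrMr // ltW // archi_boundP // divr_ge0 // ltW.
pose C : R := 2 * 4 ^+ m * (1 + meet_const R g k (2 * m * #|new_edges EH|)) ^+ (2 * m).
have C0 : 0 <= C by rewrite !mulr_ge0 // exprn_even_ge0 // oddM.
near=> n.
have Phi1 : 1 <= Phi R g k n (p n) EH by near: n; apply: hPhi.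
have Phi0 := lt_le_trans ltr01 Phi1.
have le_n : (2 * (g + k) <= n)%N by near: n; apply: nbhs_infty_ge.
have n_gt0 : (0 < n)%N by near: n; apply: nbhs_infty_gt.
have gn : (g <= n)%N by lia.
have p0 := Phi_gt0_p_gt0 hEH hGH gn (p_ge0 n) Phi0.
have n0 : 0 < n%:R :> R by rewrite ltr0n.
rewrite ger0_norm ?subr_ge0 //.
apply: le_trans (Pr_good_ge hEH hGH p0 (p_le1 n) n_gt0 le_n Phi0 m Phi1 (eps_gt0 n)) _.
rewrite -/C.
have le1 : n%:R ^+ g.+1 <= (eps n ^+ 2 * Phi R g k n (p n) EH) ^+ m :> R.
  apply: (@le_trans _ _ ((n%:R `^ c) ^+ m)).
    rewrite -[leRHS]powR_mulrn ?powR_ge0 // -powRrM -powR_mulrn ?ler0n //.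
    by rewrite ler_powR // ler1n.
  have hcn : n%:R `^ c <= eps n ^+ 2 * Phi R g k n (p n) EH by near: n.
  by rewrite lerXn2r ?nnegrE ?powR_ge0 // mulr_ge0 ?sqr_ge0 ?(ltW Phi0).
apply: (@le_trans _ _ (n%:R ^+ g * (C / n%:R ^+ g.+1))).
  rewrite ler_wpM2l ?exprn_ge0 // ler_wpM2l // lef_pV2 ?posrE ?exprn_gt0 //.
  by rewrite mulr_gt0 ?exprn_gt0.
have -> : n%:R ^+ g * (C / n%:R ^+ g.+1) = C / n%:R.
  have : n%:R ^+ g != 0 :> R by rewrite expf_neq0 // gt_eqF.
  rewrite exprS; move: (n%:R ^+ g) => u u0.
  by field; rewrite u0 gt_eqF.
rewrite ler_pdivrMr // mulrC -ler_pdivrMr //.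
by near: n; apply: nbhs_infty_ger.
Unshelve. all: by end_near.
Qed.
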